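(* Let $M$ be a smooth closed manifold of dimension $m \geq 2$ and let $f : M \to \mathbb{R}$ be a smooth function. Then the Reeb space $W_f$ of $f$ has the structure of a finite graph (i.e., is homeomorphic to a finite graph) if and only if every critical contour of $f$ has a star-like open neighborhood.
   Context: Smooth means of class $C^\infty$. A manifold is closed if it is compact and has no boundary (it need not be connected). Reeb space: for $x_0, x_1 \in M$ write $x_0 \sim x_1$ if $f(x_0) = f(x_1)$ and $x_0, x_1$ belong to the same connected component of the level set $f^{-1}(f(x_0))$. The Reeb space is the quotient space $W_f = M/\!\sim$ with the quotient topology, and $q_f : M \to W_f$ is the quotient map. A contour of $f$ is a connected component of a level set $f^{-1}(t)$, $t \in \mathbb{R}$. A contour is critical if it contains a critical point of $f$. A subset $A \subset M$ is saturated if it is a union of contours, i.e. $q_f^{-1}(q_f(A)) = A$. A non-empty open connected saturated subset $U \subset M$ is cylindrical if for every $z \in q_f(U)$ the set $U \setminus q_f^{-1}(z)$ has exactly two connected components. Let $C$ be a contour. An open connected saturated neighborhood $U$ of $C$ in $M$ is star-like if $U \setminus C$ is a finite disjoint union of cylindrical open connected sets. The union may be empty: $U$ can be equal to $C$ when $C$ is a connected component of $M$. A finite graph means a finite multi-graph, possibly with multiple edges and/or loops, and possibly with isolated vertices; as a topological space it is a compact (equivalently, finite) CW complex of dimension at most $1$. It need not be connected. *)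

(* Defs.v *)
From HB Require Import structures.
From mathcomp Require Import all_boot all_order all_algebra.
From mathcomp Require Import all_classical all_reals all_analysis.

Set Implicit Arguments.
Unset Strict Implicit.
Unset Printing Implicit Defensive.

Import Order.TTheory GRing.Theory Num.Theory.
Import numFieldNormedType.Exports.

Local Open Scope classical_set_scope.
Local Open Scope ring_scope.
Local Open Scope quotient_scope.

Definition homeomorphic (X Y : topologicalType) : Prop :=
  exists (g : X -> Y) (h : Y -> X),
    [/\ continuous g, continuous h, cancel g h & cancel h g].

Definition components (T : topologicalType) (A : set T) : set (set T) :=
  [set connected_component A x | x in A].

(** ** Smooth manifolds without boundary *)

(* [U] is meant to be open; the values of [g] outside [U] are irrelevant. *)
Fixpoint Ck_on (R : realType) (V W : normedModType R) (k : nat) (U : set V)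
    (g : V -> W) : Prop :=
  match k with
  | 0%N => forall x, U x -> {for x, continuous g}
  | k'.+1 => (forall x, U x -> differentiable g x) /\
             forall v, Ck_on k' U ('D_v g)
  end.

Definition smooth_on (R : realType) (V W : normedModType R) (U : set V)
    (g : V -> W) : Prop :=
  forall k, Ck_on k U g.

(* A homeomorphism from the open set [chart_dom] onto an open subset of R^m.
   Both maps are total functions; their values outside of [chart_dom] and of
   its image are irrelevant. *)
Record chart (R : realType) (m : nat) (T : topologicalType) := Chart {
  chart_dom : set T ;
  chart_fun :> T -> 'rV[R]_m ;
  chart_inv : 'rV[R]_m -> T ;
  chart_dom_open : open chart_dom ;
  chart_img_open : open (chart_fun @` chart_dom) ;
  chart_funK : forall x, chart_dom x -> chart_inv (chart_fun x) = x ;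
  chart_fun_continuous : {within chart_dom, continuous chart_fun} ;
  chart_inv_continuous :
    {within chart_fun @` chart_dom, continuous chart_inv}
}.

(* Charts take values in open subsets of R^m, so there is no boundary.  The
   carrier may be empty and need not be connected, and the atlas is not required
   to be maximal. *)
Record smoothManifold (R : realType) (m : nat) := SmoothManifold {
  manifold_carrier :> topologicalType ;
  manifold_hausdorff : hausdorff_space manifold_carrier ;
  manifold_second_countable : @second_countable manifold_carrier ;
  atlas : set (chart R m manifold_carrier) ;
  atlas_cover : forall x, exists2 c, atlas c & chart_dom c x ;
  atlas_compatible : forall c d, atlas c -> atlas d ->
    smooth_on (c @` (chart_dom c `&` chart_dom d)) (d \o chart_inv c)
}.

Section smooth_functions.
Context {R : realType} {m : nat} (M : smoothManifold R m) (f : M -> R).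

Definition smooth_fun : Prop :=
  forall c, atlas c -> smooth_on (c @` chart_dom c) (f \o chart_inv c).

(* For smooth [f], the choice of the chart [c] around [p] does not matter. *)
Definition critical_point (p : M) : Prop :=
  exists c, [/\ atlas c, chart_dom c p &
                forall v, 'd (f \o chart_inv c) (c p) v = 0].

End smooth_functions.

(** ** The Reeb space *)

Section reeb.
Context {R : realType} {T : topologicalType} (f : T -> R).

Definition level (t : R) : set T := f @^-1` [set t].

Definition contour (C : set T) : Prop := exists t, components (level t) C.

Definition reeb_rel (x y : T) : bool :=
  `[< f x = f y /\ connected_component (level (f x)) x y >].

Lemma reeb_rel_refl : reflexive reeb_rel.
Proof. by move=> x; apply/asboolP; split => //; exact: connected_component_refl. Qed.

Lemma reeb_rel_sym : symmetric reeb_rel.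
Proof.
suff h x y : reeb_rel x y -> reeb_rel y x by move=> x y; apply/idP/idP => /h.
move=> /asboolP[fxy cxy]; apply/asboolP; split => //.
by rewrite -fxy; exact: connected_component_sym.
Qed.

Lemma reeb_rel_trans : transitive reeb_rel.
Proof.
move=> y x z /asboolP[fxy cxy] /asboolP[fyz cyz]; apply/asboolP.
split; first by rewrite fxy.
by apply: connected_component_trans cxy _; rewrite fxy.
Qed.

Canonical reeb_equiv := EquivRel reeb_rel reeb_rel_refl reeb_rel_sym reeb_rel_trans.

Definition reeb_space : topologicalType := quotient_topology {eq_quot reeb_equiv}.

Definition reeb_map : T -> reeb_space := \pi_{eq_quot reeb_equiv}.

Definition saturated (A : set T) : Prop := reeb_map @^-1` (reeb_map @` A) = A.

Definition cylindrical (U : set T) : Prop :=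
  [/\ U !=set0, open U, connected U, saturated U &
      forall z, (reeb_map @` U) z ->
        (components (U `\` reeb_map @^-1` [set z]) #= `I_2)%card].

Definition star_like (C U : set T) : Prop :=
  [/\ open U, connected U, saturated U, C `<=` U &
      exists F : set (set T),
        [/\ finite_set F, (forall V, F V -> cylindrical V),
            trivIset F id & U `\` C = \bigcup_(V in F) V]].

End reeb.

Definition critical_contour (R : realType) (m : nat) (M : smoothManifold R m)
    (f : M -> R) (C : set M) : Prop :=
  contour f C /\ exists2 p, C p & critical_point f p.

(** ** Finite graphs *)

Record finGraph := FinGraph {
  vertex : finType ;
  edge : finType ;
  source : edge -> vertex ;
  target : edge -> vertex
}.

(* The geometric realization: the quotient of the disjoint union of the closed
   cells (a point for each vertex, a copy of [0, 1] for each edge) that attaches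
   the end 0 of each edge to its source and the end 1 to its target. *)
Section realization.
Variables (R : realType) (G : finGraph).

Definition cell (i : vertex G + edge G) : set R :=
  match i with inl _ => [set 0] | inr _ => `[0, 1] end.

Definition cells : topologicalType := {i : (vertex G + edge G)%type & set_type (cell i)}.

Definition attach (p : cells) : vertex G + edge G * R :=
  let t := set_val (projT2 p) in
  match projT1 p with
  | inl v => inl v
  | inr e => if t == 0 then inl (source e)
             else if t == 1 then inl (target e) else inr (e, t)
  end.

Definition graph_rel (p q : cells) : bool := attach p == attach q.

Lemma graph_rel_refl : reflexive graph_rel.
Proof. by move=> p; exact: eqxx. Qed.

Lemma graph_rel_sym : symmetric graph_rel.
Proof. by move=> p q; exact: eq_sym. Qed.

Lemma graph_rel_trans : transitive graph_rel.
Proof. by move=> q p r /eqP pq /eqP qr; apply/eqP; rewrite pq. Qed.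

Canonical graph_equiv := EquivRel graph_rel graph_rel_refl graph_rel_sym graph_rel_trans.

Definition graph_space : topologicalType := quotient_topology {eq_quot graph_equiv}.

End realization.

Definition is_finite_graph (R : realType) (X : topologicalType) : Prop :=
  exists G : finGraph, homeomorphic X (graph_space R G).

(* Main.v *)
Require Import Defs.
From HB Require Import structures.
From mathcomp Require Import all_boot all_order all_algebra.
From mathcomp Require Import all_classical all_reals all_analysis.
From mathcomp Require Import lra.

Set Implicit Arguments.
Unset Strict Implicit.
Unset Printing Implicit Defensive.

Import Order.TTheory GRing.Theory Num.Theory.
Import numFieldNormedType.Exports.

Local Open Scope classical_set_scope.
Local Open Scope ring_scope.

(* A finite graph has star neighborhoods, and they pull back along the quotient
   map, whose fibers are connected, to star-like neighborhoods of contours.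

   Conversely, a cylindrical set [V] of the Reeb space [X] is an open arc.  Cutting
   [V] at three points, none of which separates the other two, would select for
   each point the component pointing away from them; the maximal components
   of this kind form a countable connected set of points on which [f] is
   constant, hence a single point, which is absurd.  So each half of [V] is totally
   ordered by separation, and
   [z |-> sum_n 2^-n sup_(d_n <= w <= z) |f w - f d_n|], with [d] a dense
   sequence, is a homeomorphism from it onto an interval: it is increasing since a
   connected subset of [X] on which [f] is constant is a point.  The end of
   such a half either converges to the center of the star or leaves a
   neighborhood of it.  A contour without critical points has an arc of [X] as a
   neighborhood, because the level sets near it form one contour each.  By
   compactness [X] is the union of a finite set and finitely many arcs with open
   interiors; subdividing all of them at the finite set and at all endpoints
   gives the edges of a graph. *)

(** * General topology and the Reeb quotient *)

(** Cylindrical sets are given by a count of components alone: no chart, order or metric comes with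
    them, so the arc structure has to be read off the two sides of each cut. The danger is branching
    around a center that is not a point of the set; countability excludes it, because different
    branches contain disjoint non-empty open sets. The function f is no coordinate on such a set,
    since it need not be monotone there; its accumulated oscillations are monotone, and strictly so
    because f is nowhere constant on a segment.

    The argument takes place in X, which must be Hausdorff. This rests on components and
    quasi-components of compact level sets being the same: every neighborhood of a contour then
    contains a saturated one.

    Arcs are required to have open interiors so that two pieces without subdivision points inside
    are equal as soon as they meet, whichever arcs they were cut from; overlaps then need no further
    treatment. *)

Lemma disjointE T (A B : set T) x : A `&` B = set0 -> A x -> B x -> False.
Proof. by move=> d Ax Bx; rewrite -[False]/(set0 x) -d. Qed.

Section general_topology.
Context {T : topologicalType}.
Implicit Types (A B C K O U V : set T) (x y : T).

(** The form of connectedness used throughout: the two open sets need to be disjoint only inside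
    [A], so ambient open sets serve without passing to the subspace. *)
Lemma connected_open_split A U V : connected A -> open U -> open V ->
  A `<=` U `|` V -> A `&` (U `&` V) = set0 -> A `<=` U \/ A `<=` V.
Proof.
move=> cA oU oV AUV dis.
have [[x [Ax Ux]]|nU] := pselect (A `&` U !=set0); last first.
  right=> y Ay; have [Uy|//] := AUV _ Ay.
  by exfalso; apply: nU; exists y.
left; have <- : A `&` U = A; last by apply: subIset; right.
apply: cA; first by exists x.
  by exists U.
exists (~` V); first exact: open_closedC.
apply/seteqP; split=> y [Ay].
  by move=> Uy; split => // Vy; have : (A `&` (U `&` V)) y by []; rewrite dis.
by move=> nVy; split => //; have [|/nVy] := AUV _ Ay.
Qed.

Lemma connected_openP A :
  (forall U V, open U -> open V -> A `<=` U `|` V -> A `&` (U `&` V) = set0 ->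
     A `<=` U \/ A `<=` V) -> connected A.
Proof.
move=> h B [b Bb] [C oC BC] [D cD BD].
have [||||AC|AD] := h C (~` D).
- exact: oC.
- exact: closed_openC.
- move=> x Ax; have [Dx|] := pselect (D x); last by right.
  by left; have : (A `&` D) x by []; rewrite -BD BC => -[].
- apply/seteqP; split => // x [Ax [Cx nDx]]; apply: nDx.
  by have : (A `&` C) x by []; rewrite -BC BD => -[].
- by rewrite BC; apply/setIidPl.
- by exfalso; move: Bb; rewrite BD => -[/AD].
Qed.

(** The class of a point and its complement are both relatively open. The Euclidean condition,
    combined with reflexivity, supplies symmetry as well as transitivity. *)
Lemma connected_equiv A (r : T -> T -> Prop) : connected A ->
  (forall x, A x -> r x x) ->
  (forall x y z, A x -> A y -> A z -> r x y -> r z y -> r x z) ->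
  (forall x, A x -> \forall y \near x, A y -> r x y) ->
  forall x y, A x -> A y -> r x y.
Proof.
move=> cA rr rt ro x y Ax Ay.
have rs a b : A a -> A b -> r a b -> r b a.
  by move=> Aa Ab ab; apply: (rt b b a) => //; exact: rr.
have rt' a b c : A a -> A b -> A c -> r a b -> r b c -> r a c.
  by move=> Aa Ab Ac ab bc; apply: (rt a b c) => //; exact: rs.
(* Both predicates hold vacuously off [A], so that their interiors in [T] express relative openness
   in [A]. *)
pose P z := A z -> r x z; pose Q z := A z -> ~ r x z.
have [||||h|h] := @connected_open_split A (P : set T)° (Q : set T)° cA.
- exact: open_interior.
- exact: open_interior.
- move=> z Az; have [xz|nxz] := pselect (r x z); [left|right].
    apply: filterS (ro _ Az) => w zw Aw; exact: (rt' x z w Ax Az Aw xz (zw Aw)).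
  apply: filterS (ro _ Az) => w zw Aw xw; apply: nxz.
  by apply: (rt x w z) => //; exact: zw.
- apply/seteqP; split => // z [Az [/interior_subset pz /interior_subset qz]].
  by apply: (qz Az); exact: pz.
- exact: (interior_subset (h _ Ay)).
- by have := interior_subset (h _ Ax) Ax; case; exact: rr.
Qed.

(** Compactness as an induction principle. If [P K] failed, the sets whose complement in [K]
    satisfies [P] would form a proper filter containing [K], and a cluster point of it would
    contradict the local hypothesis. *)
Lemma compact_set_ind K (P : set T -> Prop) : compact K ->
  P set0 -> (forall A B, A `<=` B -> P B -> P A) ->
  (forall A B, P A -> P B -> P (A `|` B)) ->
  (forall x, K x -> exists2 N, nbhs x N & P N) -> P K.
Proof.
move=> cK P0 PS PU Ploc; apply: contrapT => nPK.
pose F := [set A | P (K `\` A)].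
have FF : ProperFilter F.
  split; first by rewrite /F /= setD0.
  split; first by rewrite /F /= setDT.
    by move=> A B FA FB; rewrite /F /= setDIr; exact: PU.
  by move=> A B AB; apply: PS => x [Kx nBx]; split => // /AB.
have [|x [Kx cx]] := cK F FF; first by rewrite /F /= setDv.
have [N Nx PN] := Ploc x Kx.
have FN : F (~` N) by apply: PS PN => y [_ /contrapT].
by have [y [nNy Ny]] := cx _ _ FN Nx.
Qed.

Definition locally_connected := forall x O, open O -> O x ->
  exists N, [/\ open N, connected N, N x & N `<=` O].

Lemma component_open x O : locally_connected -> open O ->
  open (connected_component O x).
Proof.
move=> lc oO; rewrite openE => y [B [Bx BO cB] By].
have [N [oN cN Ny NO]] := lc y O oO (BO _ By).
apply: filterS (open_nbhs_nbhs (conj oN Ny)) => z Nz.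
exists (B `|` N); last by right.
split; [by left|by rewrite subUset|].
by apply: connectedU => //; exists y.
Qed.

Lemma compact_open_between A O : hausdorff_space T -> compact [set: T] ->
  closed A -> open O -> A `<=` O ->
  exists W, [/\ open W, A `<=` W & closure W `<=` O].
Proof.
move=> hT cT clA oO AO; have := compact_normal hT cT clA => /(_ O)[].
  by apply/set_nbhsP; exists O; split.
move=> V /set_nbhsP[W [oW AW WV]] clV; exists W; split => //.
by apply: subset_trans clV; exact: closureS.
Qed.

(* In a compact Hausdorff space components and quasi-components coincide. *)
Lemma component_clopen_nbhd K x O : hausdorff_space T -> compact [set: T] ->
  closed K -> K x -> open O -> connected_component K x `<=` O ->
  exists D, [/\ D x, D `<=` O, D `<=` K, closed D & closed (K `\` D)].
Proof.
move=> hT cT cK Kx oO CO.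
pose DD := [set D | [/\ D x, D `<=` K, closed D & closed (K `\` D)]].
pose Q := \bigcap_(D in DD) D.
have DI D D' : DD D -> DD D' -> DD (D `&` D').
  move=> [Dx DK cD cD'] [D'x D'K c'D c'D']; split => //.
  - by move=> z [/DK].
  - exact: closedI.
  - by rewrite setDIr; exact: closedU.
have DK : DD K.
  by split => //; rewrite setDv; exact: closed0.
(* Compactness of the part of [K] outside [O']: an inclusion that holds for the intersection [Q]
   already holds for one member of [DD], which is stable under finite intersections. *)
have small O' : open O' -> Q `<=` O' -> exists2 D, DD D & D `<=` O'.
  move=> oO' QO'.
  have cKO : compact (K `\` O').
    apply: (@subclosed_compact _ _ setT) => //.
    by rewrite setDE; apply: closedI => //; exact: open_closedC.
  have [|A B AB [D dD DB]|A B [D dD DA] [D' dD' D'B]|y [Ky nO'y]|D dD h] :=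
    @compact_set_ind _ (fun A => exists2 D, DD D & D `&` A = set0) cKO.
  - by exists K => //; rewrite setI0.
  - exists D => //; apply/seteqP; split => // z [Dz Az].
    by rewrite -DB; split => //; exact: AB.
  - exists (D `&` D'); first exact: DI.
    apply/seteqP; split => // z [[Dz D'z] [Az|Bz]].
      by rewrite -DA.
    by rewrite -D'B.
  - have [D dD nDy] : exists2 D, DD D & ~ D y.
      apply: contrapT => h; apply: nO'y; apply: QO' => D dD.
      by apply: contrapT => nDy; apply: h; exists D.
    exists (~` D); last by exists D => //; rewrite setICr.
    by apply: open_nbhs_nbhs; split => //; apply: closed_openC; case: dD.
  - exists D => // z Dz; apply: contrapT => nO'z.
    by rewrite -[False]/(set0 z) -h; split => //; split => //; case: dD => _ /(_ _ Dz).
have cQ : connected Q.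
  have clQ : closed Q by apply: closed_bigI => D [].
  apply: connected_openP => U V oU oV QUV dis.
  have clA : closed (Q `\` V) by rewrite setDE; apply: closedI => //; exact: open_closedC.
  have clB : closed (Q `\` U) by rewrite setDE; apply: closedI => //; exact: open_closedC.
  have [||W [oW AW clW]] := @compact_open_between (Q `\` V) (~` (Q `\` U)) hT cT clA.
    exact: closed_openC.
    by move=> z [Qz nVz] [_ nUz]; have [/nUz|/nVz] := QUV _ Qz.
  pose OB := ~` closure W.
  have oOB : open OB by apply: closed_openC; exact: closed_closure.
  have BOB : Q `\` U `<=` OB.
    by move=> z Bz cz; exact: (clW z).
  have dWO : W `&` OB = set0.
    by apply/seteqP; split => // z [Wz]; apply; exact: subset_closure.
  have QWO : Q `<=` W `|` OB.
    move=> z Qz; have [Vz|nVz] := pselect (V z).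
      right; apply: BOB; split => // Uz.
      by have : (Q `&` (U `&` V)) z by []; rewrite dis.
    by left; apply: AW.
  have [D [Dx DK' cD cKD] DWO] := small _ (openU oW oOB) QWO.
  (* Disjoint open sets cut [D] into relatively clopen pieces; the piece containing [x] belongs to
     [DD] again, hence contains all of [Q]. *)
  have split1 G H : open G -> open H -> G `&` H = set0 -> D `<=` G `|` H -> G x ->
      Q `<=` G.
    move=> oG oH dGH DGH Gx.
    suff : DD (D `&` G) by move=> h z /(_ _ h)[].
    split => //; [by move=> z [/DK']| |].
    + have -> : D `&` G = D `\` H.
        apply/seteqP; split=> z [Dz].
          by move=> Gz; split => // Hz; rewrite -[False]/(set0 z) -dGH.
        by move=> nHz; split => //; have [|/nHz] := DGH _ Dz.
      by rewrite setDE; apply: closedI => //; exact: open_closedC.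
    + have -> : K `\` (D `&` G) = (K `\` D) `|` (D `\` G).
        apply/seteqP; split => z.
          move=> [Kz nDG]; have [Dz|nDz] := pselect (D z); last by left.
          by right; split => // Gz; apply: nDG.
        by move=> [[Kz nDz]|[Dz nGz]]; split; [| move=> []|exact: DK'|move=> []].
      apply: closedU => //.
      by rewrite setDE; apply: closedI => //; exact: open_closedC.
  have [Wx|Ox] := DWO _ Dx.
    left=> z Qz; apply: contrapT => nUz.
    have Wz := split1 _ _ oW oOB dWO DWO Wx z Qz.
    by rewrite -[False]/(set0 z) -dWO; split => //; exact: BOB.
  right=> z Qz; apply: contrapT => nVz.
  have DOW : D `<=` OB `|` W by rewrite setUC.
  have Wz := split1 _ _ oOB oW (etrans (setIC _ _) dWO) DOW Ox z Qz.
  by rewrite -[False]/(set0 z) -dWO; split => //; exact: AW.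
have QC : Q `<=` O.
  apply: subset_trans CO; apply: connected_component_max => //.
  - by move=> D [].
  - by move=> z /(_ _ DK).
by have [D [Dx ? ? ?] DO] := small _ oO QC; exists D.
Qed.

End general_topology.
Arguments locally_connected : clear implicits.

(** * Point-set topology of the Reeb quotient *)

Section reeb_quotient.
Context {R : realType} {T : topologicalType} (f : T -> R).
Local Notation X := (reeb_space f).
Local Notation q := (reeb_map f).

Lemma reeb_map_surj (z : X) : exists x, q x = z.
Proof. by exists (repr z); rewrite /reeb_map reprK. Qed.

Lemma reeb_mapP x y :
  q x = q y <-> f x = f y /\ connected_component (level f (f x)) x y.
Proof.
split; first by move/eqmodP/asboolP.
by move=> h; apply/eqmodP/asboolP.
Qed.

Lemma reeb_map_cts : continuous q.
Proof. exact: pi_continuous. Qed.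

Lemma reeb_fiber x : q @^-1` [set q x] = connected_component (level f (f x)) x.
Proof.
apply/seteqP; split=> y.
  by move=> /= /esym/reeb_mapP[].
move=> h; apply/esym/reeb_mapP; split => //.
by have /connected_component_sub := h => /esym.
Qed.

Lemma reeb_fiber_connected (z : X) : connected (q @^-1` [set z]).
Proof.
by have [x <-] := reeb_map_surj z; rewrite reeb_fiber; exact: component_connected.
Qed.

Lemma reeb_image_preimage (B : set X) : q @` (q @^-1` B) = B.
Proof. by rewrite image_preimage //; apply/seteqP; split => // z _; have [x <-] := reeb_map_surj z; exists x. Qed.

Lemma saturated_preimage (B : set X) : saturated f (q @^-1` B).
Proof. by rewrite /saturated reeb_image_preimage. Qed.

Lemma saturatedP (A : set T) :
  saturated f A <-> (forall x y, A x -> q x = q y -> A y).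
Proof.
split=> [sA x y Ax xy|h].
  by rewrite -sA /=; exists x.
apply/seteqP; split => x; last by exists x.
by move=> [y Ay yx]; exact: h yx.
Qed.

Lemma reeb_openP (B : set X) : open B <-> open (q @^-1` B).
Proof. by []. Qed.

Lemma reeb_closedP (B : set X) : closed B <-> closed (q @^-1` B).
Proof. by rewrite -!openC; exact: reeb_openP. Qed.

Lemma saturated_open (A : set T) : saturated f A -> open A -> open (q @` A).
Proof. by move=> sA oA; apply/reeb_openP; rewrite sA. Qed.

(** Fibers are connected, so each of them lies wholly in [U] or wholly in [V]; the traces of [U] and
    [V] are then saturated and descend to disjoint open sets covering [B]. *)
Lemma connected_preimage_open (B : set X) : open B -> connected B ->
  connected (q @^-1` B).
Proof.
move=> oB cB; apply: connected_openP => U V oU oV BUV dis.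
have oqB : open (q @^-1` B) by [].
pose U' := U `&` q @^-1` B; pose V' := V `&` q @^-1` B.
have sep z : B z -> q @^-1` [set z] `<=` U \/ q @^-1` [set z] `<=` V.
  move=> Bz; apply: connected_open_split => //; first exact: reeb_fiber_connected.
    by move=> x /= xz; apply: BUV; rewrite /= xz.
  apply/seteqP; split => // x [/= xz [Ux Vx]].
  by apply: (disjointE dis (x := x)) => //=; rewrite xz.
have sU : saturated f U'.
  apply/saturatedP => x y [Ux /= Bx] xy; rewrite /U' /= -xy; split => //.
  have [h|h] := sep _ Bx; first exact: h.
  by exfalso; apply: (disjointE dis (x := x)) => //; split => //; exact: h.
have sV : saturated f V'.
  apply/saturatedP => x y [Vx /= Bx] xy; rewrite /V' /= -xy; split => //.
  have [h|h] := sep _ Bx; last exact: h.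
  by exfalso; apply: (disjointE dis (x := x)) => //; split => //; exact: h.
have [||||h|h] := @connected_open_split _ B (q @` U') (q @` V') cB.
- by apply: saturated_open => //; exact: openI.
- by apply: saturated_open => //; exact: openI.
- move=> z Bz; have [x xz] := reeb_map_surj z.
  have [|Ux|Vx] := BUV x; first by rewrite /= xz.
    by left; exists x => //; split => //=; rewrite xz.
  by right; exists x => //; split => //=; rewrite xz.
- apply/seteqP; split => // z [Bz [[x [Ux Bx] xz] [y Vy yz]]].
  have [Vx _] : V' x by move/saturatedP : sV; apply; [exact: Vy|rewrite yz].
  exact: (disjointE dis (x := x)).
- left=> x /= /h [y Uy yx].
  by have [] : U' x by move/saturatedP : sU; apply; [exact: Uy|].
- right=> x /= /h [y Uy yx].
  by have [] : V' x by move/saturatedP : sV; apply; [exact: Uy|].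
Qed.

(** The traces of [U] and [V] on a closed preimage need not be open, so the splitting descends
    through complements: the points of [B] whose fiber is not inside [U] form a closed set. *)
Lemma connected_preimage_closed (B : set X) : closed B -> connected B ->
  connected (q @^-1` B).
Proof.
move=> clB cB; apply: connected_openP => U V oU oV BUV dis.
have clqB : closed (q @^-1` B) by apply/reeb_closedP.
have sep z : B z -> q @^-1` [set z] `<=` U \/ q @^-1` [set z] `<=` V.
  move=> Bz; apply: connected_open_split => //; first exact: reeb_fiber_connected.
    by move=> x /= xz; apply: BUV; rewrite /= xz.
  apply/seteqP; split => // x [/= xz [Ux Vx]].
  by apply: (disjointE dis (x := x)) => //=; rewrite xz.
pose B' W := [set z | B z /\ ~ (q @^-1` [set z] `<=` W)].
have clB' W1 W2 : open W1 -> (forall z, B z -> q @^-1` [set z] `<=` W1 \/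
    q @^-1` [set z] `<=` W2) -> q @^-1` B `&` (W1 `&` W2) = set0 -> closed (B' W1).
  move=> oW s d; apply/reeb_closedP.
  have -> : q @^-1` (B' W1) = q @^-1` B `&` ~` W1.
    apply/seteqP; split=> x /= [Bx nW]; split => //.
      have [//|h] := s _ Bx => W1x.
      by apply: (disjointE d (x := x)) => //; split => //; exact: h.
    by apply: contra_not nW; apply.
  by apply: closedI => //; exact: open_closedC.
have [||||h|h] := @connected_open_split _ B (~` B' U) (~` B' V) cB.
- by apply: closed_openC; exact: clB' sep dis.
- apply: closed_openC; apply: (clB' _ U) => //; last by rewrite [V `&` U]setIC.
  by move=> z /sep[]; [right|left].
- by move=> z Bz; have [h|h] := sep z Bz; [left|right] => -[].
- apply/seteqP; split => // z [Bz [nU nV]]; have [x xz] := reeb_map_surj z.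
  have zU : q @^-1` [set z] `<=` U by apply: contrapT => h; exact: nU.
  have zV : q @^-1` [set z] `<=` V by apply: contrapT => h; exact: nV.
  by apply: (disjointE dis (x := x)); [rewrite /= xz|split; [exact: zU|exact: zV]].
- left=> x /= Bx; have := h _ Bx; apply: contra_notP => nUx.
  by split => // /(_ x erefl).
- right=> x /= Bx; have := h _ Bx; apply: contra_notP => nUx.
  by split => // /(_ x erefl).
Qed.

Definition reeb_fun (z : X) : R := f (repr z).

Lemma reeb_funE x : reeb_fun (q x) = f x.
Proof.
have : q (repr (q x)) = q x by rewrite /reeb_map reprK.
by move=> /reeb_mapP[].
Qed.

Lemma reeb_fun_cts : continuous f -> continuous reeb_fun.
Proof.
move=> cf; apply/quotient_continuous.
by rewrite (_ : _ \o _ = f) //; apply/funext => x; exact: reeb_funE.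
Qed.

Lemma reeb_compact : compact [set: T] -> compact [set: X].
Proof.
move=> cT; have <- : q @` setT = setT.
  by apply/seteqP; split => // z _; have [x <-] := reeb_map_surj z; exists x.
by apply: continuous_compact => //; apply: continuous_subspaceT; exact: reeb_map_cts.
Qed.

(** Preimages are known to be connected for closed sets, so [S] is replaced by its closure, on which
    the function is still constant. The connected preimage lies in one level set, hence in one
    contour. *)
Lemma reeb_light (S : set X) t : continuous f -> connected S ->
  (forall z, S z -> reeb_fun z = t) -> forall z w, S z -> S w -> z = w.
Proof.
move=> cf cS St z w Sz Sw.
have cSt : forall y, closure S y -> reeb_fun y = t.
  move=> y; suff : closure S `<=` reeb_fun @^-1` [set t] by apply.
  have /closure_id -> : closed (reeb_fun @^-1` [set t]).
    by apply: closed_comp => [u _|]; [exact: reeb_fun_cts|exact: closed_eq].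
  by apply: closureS => u /St.
have cc := connected_preimage_closed (@closed_closure _ S) (connected_closure cS).
have [x xz] := reeb_map_surj z; have [y yw] := reeb_map_surj w.
have Cx : closure S (q x) by rewrite xz; exact: subset_closure.
have Cy : closure S (q y) by rewrite yw; exact: subset_closure.
have fx : f x = t by rewrite -reeb_funE; exact: cSt.
rewrite -xz -yw; apply/reeb_mapP; split.
  by rewrite fx -reeb_funE; apply/esym; exact: cSt.
exists (q @^-1` closure S) => //; split => // u /= Cu.
by rewrite /level /= fx -(cSt _ Cu) reeb_funE.
Qed.

(** A component of the preimage of [O] is saturated, because a connected fiber that meets it stays
    in it; its image is the neighborhood sought. *)
Lemma reeb_locally_connected : locally_connected T -> locally_connected X.
Proof.
move=> lc z O oO Oz; have [x xz] := reeb_map_surj z.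
pose K := connected_component (q @^-1` O) x.
have Kx : K x by apply: connected_component_refl; rewrite /= xz.
have sK : saturated f K.
  apply/saturatedP => y y' Ky yy'; apply: connected_component_trans (Ky) _.
  exists (q @^-1` [set q y]) => //; split => //.
    move=> u /= ->; exact: (connected_component_sub Ky).
  exact: reeb_fiber_connected.
exists (q @` K); split.
- by apply: saturated_open => //; exact: component_open.
- apply: connected_continuous_connected; first exact: component_connected.
  by apply: continuous_subspaceT; exact: reeb_map_cts.
- by exists x.
- by move=> _ [y /connected_component_sub + <-].
Qed.

Hypotheses (cf : continuous f) (hT : hausdorff_space T) (cT : compact [set: T]).

Lemma reeb_fiber_closed (z : X) : closed (q @^-1` [set z]).
Proof.
have [x <-] := reeb_map_surj z; rewrite reeb_fiber; apply: component_closed.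
by apply: closed_comp => [u _|]; [exact: cf|exact: closed_eq].
Qed.

(** Upper semicontinuity of contours. A relatively clopen part [D] of the level contains the contour
    and lies in [O]; disjoint open sets [O1] and [O2] around [D] and the rest of the level leave a
    compact remainder [K] on which [f] stays at distance at least [e] from [t]. A contour whose
    level is within [e] of [t] is therefore contained in [O1] or in [O2]. *)
Lemma reeb_saturated_nbhd (z : X) (O : set T) : open O -> q @^-1` [set z] `<=` O ->
  exists G : set X, [/\ open G, G z & q @^-1` G `<=` O].
Proof.
have [x <-] := reeb_map_surj z; rewrite reeb_fiber; set t := f x => oO CO.
have clL s : closed (level f s).
  by apply: closed_comp => [u _|]; [exact: cf|exact: closed_eq].
have [D [Dx DO DL cD cLD]] := component_clopen_nbhd hT cT (clL t) erefl oO CO.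
have [||O1 [oO1 DO1 clW]] := compact_open_between (O := O `\` (level f t `\` D)) hT cT cD.
  by rewrite setDE; apply: openI => //; exact: closed_openC.
  by move=> u Du; split; [exact: DO|move=> []].
pose O2 := ~` closure O1.
have oO2 : open O2 by apply: closed_openC; exact: closed_closure.
have O1O : O1 `<=` O.
  by move=> u O1u; have [] := clW u (subset_closure O1u).
have LO : level f t `<=` O1 `|` O2.
  move=> u Lu; have [Du|nDu] := pselect (D u); first by left; exact: DO1.
  by right=> cu; have [_] := clW u cu; apply.
have d12 : O1 `&` O2 = set0.
  by apply/seteqP; split => // u [ O1u]; apply; exact: subset_closure.
pose K := ~` (O1 `|` O2).
have cK : compact K.
  apply: (@subclosed_compact _ _ setT) => //.
  by apply: open_closedC; exact: openU.
have : exists2 e : R, 0 < e & forall u, K u -> e <= `|f u - t|.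
  have [|A B AB [e e0 eB]|A B [e e0 eA] [e' e'0 eB]|u Ku|e e0 h] :=
    @compact_set_ind _ K (fun A => exists2 e : R, 0 < e & forall u, A u -> e <= `|f u - t|) cK.
  - by exists 1.
  - by exists e => // u /AB /eB.
  - exists (Num.min e e'); first by rewrite lt_min e0.
    by move=> u [/eA|/eB]; rewrite ge_min => ->; rewrite ?orbT.
  - have fu : f u != t by apply/eqP => fut; apply: Ku; exact: LO.
    have e0 : 0 < `|f u - t| / 2 by rewrite divr_gt0 // normr_gt0 subr_eq0.
    exists (f @^-1` ball (f u) (`|f u - t| / 2)).
      by apply: cf; exact: nbhsx_ballx.
    exists (`|f u - t| / 2) => // v /=; rewrite /ball /= => fuv.
    have := ler_distD (f v) (f u) t; lra.
  - by exists e.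
move=> [e e0 eK].
pose G := O1 `&` f @^-1` ball t e.
have oG : open G.
  by apply: openI => //; apply: open_comp => [u _|]; [exact: cf|exact: ball_open].
have sG : saturated f G.
  apply/saturatedP => u v [ O1u fu] /reeb_mapP [fuv cuv].
  split; last by rewrite /= -fuv.
  have [|||||h|h] := @connected_open_split _ (connected_component (level f (f u)) u) O1 O2.
  - exact: component_connected.
  - by [].
  - by [].
  - move=> w /connected_component_sub Lw; apply: contrapT => Kw.
    have := eK w Kw; rewrite Lw; move: fu; rewrite /= /ball /= distrC => fu fu'.
    by have := lt_le_trans fu fu'; rewrite ltxx.
  - by rewrite d12 setI0.
  - exact: h.
  - have : O2 u by apply: h; exact: connected_component_refl.
    by move=> /(_ (subset_closure O1u)).
exists (q @` G); split.
- exact: saturated_open.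
- by exists x => //; split; [exact: DO1|exact: ballxx].
- by rewrite sG => u [/O1O].
Qed.

Lemma reeb_hausdorff : hausdorff_space X.
Proof.
rewrite open_hausdorff => z w zw.
have clz := @reeb_fiber_closed z; have clw := @reeb_fiber_closed w.
have [||O1 [oO1 zO1 clW]] := compact_open_between (O := ~` (q @^-1` [set w])) hT cT clz.
  exact: closed_openC.
  by move=> u /= uz uw; move: zw; rewrite -uz -uw eqxx.
have [G1 [oG1 G1z G1O]] := reeb_saturated_nbhd oO1 zO1.
have [||G2 [oG2 G2w G2O]] := @reeb_saturated_nbhd w (~` closure O1).
  by apply: closed_openC; exact: closed_closure.
  by move=> u /= uw cu; exact: (clW u).
exists (G1, G2); rewrite /= ?inE; first by split.
split => //; apply/seteqP; split => // y [G1y G2y].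
have [u uy] := reeb_map_surj y.
apply: (G2O u); first by rewrite /= uy.
by apply: subset_closure; apply: G1O; rewrite /= uy.
Qed.

End reeb_quotient.

(** * Cut points and the absence of branching *)

Section cuts.
Context {X : topologicalType}.
Implicit Types (A S T U V N : set X).

(** Keeps the two sides of a cut as named data: order and branching are later expressed by
    inclusions between sides, and the openness of the sides is what the connectedness arguments
    use. *)
Record cut2 A u S T : Prop := Cut {
  cut_oS : open S; cut_oT : open T; cut_cS : connected S; cut_cT : connected T;
  cut_S0 : S !=set0; cut_T0 : T !=set0; cut_d : S `&` T = set0;
  cut_E : A `\ u = S `|` T }.

Definition cyl A := [/\ A !=set0, open A, connected A &
  forall u, A u -> exists S T, cut2 A u S T].

Lemma cut_sym A u S T : cut2 A u S T -> cut2 A u T S.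
Proof. by case=> *; split => //; rewrite 1?setIC 1?setUC. Qed.

Lemma cutP A u S T x : cut2 A u S T -> A x -> [\/ x = u, S x | T x].
Proof.
move=> h Ax; have [->|/eqP xu] := pselect (x = u); first by constructor 1.
have : (A `\ u) x by split => //; exact/eqP.
by rewrite (cut_E h) => -[]; [constructor 2|constructor 3].
Qed.

Lemma cut_subS A u S T x : cut2 A u S T -> S x -> A x /\ x <> u.
Proof.
by move=> h Sx; have : (A `\ u) x by rewrite (cut_E h); left.
Qed.

Lemma cut_subT A u S T x : cut2 A u S T -> T x -> A x /\ x <> u.
Proof. by move=> /cut_sym; exact: cut_subS. Qed.

(** If [u] could be split off, with [S] inside [U] and [u] in [V], then [S] and the union of [T] and
    [V] would split the connected set [A]. *)
Lemma cut_conn A u S T : open A -> connected A -> A u -> cut2 A u S T ->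
  connected (S `|` [set u]).
Proof.
move=> oA cA Au h; have [s Ss] := cut_S0 h.
have aux U V : open U -> open V -> S `|` [set u] `<=` U `|` V ->
    (S `|` [set u]) `&` (U `&` V) = set0 -> S `<=` U -> S `|` [set u] `<=` U.
  move=> oU oV cUV d SU x [/SU//|->].
  have [//|Vu] := cUV u (or_intror erefl); exfalso.
  have [||x' Ax'||h'|h'] := @connected_open_split _ A S (T `|` V) cA.
  - exact: cut_oS h.
  - by apply: openU => //; exact: cut_oT h.
  - by case: (cutP h Ax') => [->|Sx|Tx]; [right; right|left|right; left].
  - apply/seteqP; split => // y [Ay [Sy [Ty|Vy]]].
      exact: (disjointE (cut_d h) Sy Ty).
    by apply: (disjointE d (x := y)); [left|split => //; exact: SU].
  - by have [] := cut_subS h (h' _ Au).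
  - have [Ts|Vs] := h' _ (cut_subS h Ss).1.
      exact: (disjointE (cut_d h) Ss Ts).
    by apply: (disjointE d (x := s)); [left|split => //; exact: SU].
apply: connected_openP => U V oU oV cUV d.
have [||||SU|SV] := @connected_open_split _ S U V (cut_cS h) => //.
- by move=> x Sx; apply: cUV; left.
- apply/seteqP; split => // x [Sx UV].
  by apply: (disjointE d (x := x)) => //; left.
- by left; exact: aux d SU.
- by right; apply: aux SV; [exact: oV|exact: oU|rewrite [V `|` U]setUC|rewrite [V `&` U]setIC].
Qed.

Section two_cuts.
Variables (A : set X) (u v : X) (S T S' T' : set X).
Hypotheses (oA : open A) (cA : connected A) (Au : A u).
Hypotheses (h : cut2 A u S T) (h' : cut2 A v S' T').

Lemma cut_same B z w : connected B -> B `<=` A `\ u -> B z -> B w -> S z -> T w ->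
  False.
Proof.
move=> cB BA Bz Bw Sz Tw.
have [||||k|k] := @connected_open_split _ B S T cB.
- exact: cut_oS h.
- exact: cut_oT h.
- by move=> x /BA; rewrite (cut_E h).
- by rewrite (cut_d h) setI0.
- exact: (disjointE (cut_d h) (k _ Bw) Tw).
- exact: (disjointE (cut_d h) Sz (k _ Bz)).
Qed.

(** [S] with [u] added is connected and misses [v], so it lies on one side of [v], the one that it
    is known to meet. The second inclusion follows by taking complements. *)
Lemma cut_nest : S `&` S' !=set0 -> T v ->
  S `|` [set u] `<=` S' /\ T' `|` [set v] `<=` T.
Proof.
move=> [p [Sp S'p]] Tv.
have SS : S `|` [set u] `<=` S'.
  have [||||k|k] := @connected_open_split _ (S `|` [set u]) S' T' (cut_conn oA cA Au h).
  - exact: cut_oS h'.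
  - exact: cut_oT h'.
  - rewrite -(cut_E h') => x [Sx|->]; split => //=.
    + by case: (cut_subS h Sx).
    + by move=> xv; apply: (disjointE (cut_d h) Sx); rewrite xv.
    + by case: (cut_subT h Tv) => _ /nesym.
  - by rewrite (cut_d h') setI0.
  - exact: k.
  - by exfalso; apply: (disjointE (cut_d h') S'p); apply: k; left.
split => // x [T'x|->//].
case: (cutP h (cut_subT h' T'x).1) => [xu|Sx|//]; exfalso.
- by apply: (disjointE (cut_d h') (x := x)) => //; apply: SS; right.
- by apply: (disjointE (cut_d h') (x := x)) => //; apply: SS; left.
Qed.

(** The same argument for the far side: [T] with [u] added is connected, misses [v], and is placed
    by the position of [u]. In particular [T] and [T'] do not meet. *)
Lemma cut_disj : S v -> S' u -> T `|` [set u] `<=` S'.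
Proof.
move=> Sv S'u.
have [||||k|k] := @connected_open_split _ (T `|` [set u]) S' T'
  (cut_conn oA cA Au (cut_sym h)).
- exact: cut_oS h'.
- exact: cut_oT h'.
- rewrite -(cut_E h') => x [Tx|->]; split => //=.
  + by case: (cut_subT h Tx).
  + by move=> xv; apply: (disjointE (cut_d h) Sv); rewrite -xv.
  + by case: (cut_subS h Sv) => _ /nesym.
- by rewrite (cut_d h') setI0.
- exact: k.
- by exfalso; apply: (disjointE (cut_d h') S'u); apply: k; right.
Qed.

End two_cuts.

Lemma cut_nbhd A u S T N : open A -> connected A -> A u -> cut2 A u S T ->
  open N -> N u -> exists2 x, N x & S x.
Proof.
move=> oA cA Au h oN Nu; apply: contrapT => nx.
have [s Ss] := cut_S0 h.
have [||||k|k] := @connected_open_split _ (S `|` [set u]) S N (cut_conn oA cA Au h) => //.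
- exact: cut_oS h.
- by move=> x [Sx|->]; [left|right].
- by apply/seteqP; split => // x [_ [Sx Nx]]; apply: nx; exists x.
- have Su : S u by apply: k; right.
  by have [] := cut_subS h Su.
- by apply: nx; exists s => //; apply: k; left.
Qed.

Definition separates A u x y := exists S T, [/\ cut2 A u S T, S x & T y].

End cuts.

(** A countable set is Lebesgue null, whereas a connected set with two points contains an interval
    of positive length. *)
Lemma countable_connected_subsingleton (R : realType) (A : set R) x y :
  countable A -> connected A -> A x -> A y -> x = y.
Proof.
move=> ctA /connected_intervalP iA.
wlog xy : x y / x <= y.
  move=> h Ax Ay; have [xy|/ltW yx] := leP x y; first exact: h.
  by apply/esym; exact: h.
move=> Ax Ay; apply/eqP; rewrite eq_le xy /= leNgt; apply/negP => ltxy.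
have /countable_lebesgue_measure0 : countable `[x, y].
  apply: sub_countable ctA; apply: subset_card_le => z /=.
  by rewrite in_itv /= => /(iA x y Ax Ay).
by move/eqP; rewrite lebesgue_measure_itv /= lte_fin ltxy -EFinB eqe subr_eq0 gt_eqF.
Qed.

Definition dense_seq (X : topologicalType) (d : nat -> X) :=
  forall O : set X, open O -> O !=set0 -> exists n, O (d n).

Section three_points.
Context {R : realType} {X : topologicalType}.
Hypotheses (hX : hausdorff_space X) (lX : locally_connected X).
Variables (d : nat -> X) (F : X -> R).
Hypotheses (dd : dense_seq d) (cF : continuous F).
Hypothesis lightF : forall (B : set X) t, connected B ->
  (forall z, B z -> F z = t) -> forall z w, B z -> B w -> z = w.
Variable A : set X.
Hypothesis cylA : cyl A.
Let oA : open A. Proof. by case: cylA. Qed.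
Let cA : connected A. Proof. by case: cylA. Qed.

(* [T u] is the part of [A] beyond [u], seen from a fictitious center of [P]: it
   contains at most one point of [P], and [S u] at least two. *)
Section no_branching.
Variables (P : set X) (S T : X -> set X).
Hypotheses (PA : P `<=` A) (cutST : forall u, A u -> cut2 A u (S u) (T u)).
Hypotheses (SP : forall u, A u -> exists a b, [/\ P a, P b, a <> b, S u a & S u b]).
Hypotheses (TP : forall u a b, A u -> P a -> P b -> T u a -> T u b -> a = b).
Hypotheses (SS : forall u v, A u -> A v -> S u `&` S v !=set0).

Let nest u v : A u -> T u v ->
  S u `|` [set u] `<=` S v /\ T v `|` [set v] `<=` T u.
Proof.
move=> Au Tuv; have Av := (cut_subT (cutST Au) Tuv).1.
by apply: (cut_nest oA cA Au (cutST Au) (cutST Av)) => //; exact: SS.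
Qed.

Let disj u v : A u -> A v -> S u v -> S v u -> T u `|` [set u] `<=` S v.
Proof. by move=> Au Av; exact: (cut_disj oA cA Au (cutST Au) (cutST Av)). Qed.

Let TS u x : A u -> S u x -> T u x -> False.
Proof. by move=> Au; exact: (disjointE (cut_d (cutST Au))). Qed.

(** In the order meant here [v] is larger than [u] when [u] lies beyond [v], so the maximal points
    are those nearest to the fictitious center. *)
Let maxs : set X := [set e | A e /\ forall v, A v -> ~ T v e].

Let above u : set X := [set v | A v /\ (v = u \/ T v u)].

(** Otherwise each of [v] and [w] would lie on the near side of the other, which forces their far
    sides apart, although [u] lies at or beyond both. *)
Let above_nest u v w : above u v -> above u w -> [\/ v = w, T v w | T w v].
Proof.
move=> [Av vu] [Aw wu].
case: (cutP (cutST Av) Aw) => [->|Svw|]; [by constructor 1| |by constructor 2].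
case: (cutP (cutST Aw) Av) => [->|Swv|]; [by constructor 1| |by constructor 3].
exfalso; have k := disj Av Aw Svw Swv.
case: wu => [wu|]; last apply: TS => //.
  case: vu => [vu|Tvu]; last by apply: (TS Av Svw); rewrite wu.
  by have [] := cut_subS (cutST Aw) Swv; rewrite vu wu.
by apply: k; case: vu => [->|]; [right|left].
Qed.

(* If a chain had no maximal element, then its union [O] would have a unique
   boundary point [b] in [A], and [S b = O], although [O] contains at most one
   point of [P]. *)
Lemma exists_max u : A u -> exists2 e, maxs e & e = u \/ T e u.
Proof.
move=> Au; apply: contrapT => nmax.
have big v : above u v -> exists2 w, above u w & T w v.
  move=> [Av vu]; apply: contrapT => h; apply: nmax; exists v => //.
  split => // w Aw Twv; apply: h; exists w => //; split => //; right.
  have [_ k] := nest Aw Twv; apply: k.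
  by case: vu => [->|]; [right|left].
pose O := \bigcup_(v in above u) T v.
have chO v : above u v -> O v by move=> /big[w hw Twv]; exists w.
have uu : above u u by split => //; left.
have Ou := chO _ uu.
have oO : open O by apply: bigcup_open => v [Av _]; exact: cut_oT (cutST Av).
have OA : O `<=` A by move=> x [v [Av _] Tx]; exact: (cut_subT (cutST Av) Tx).1.
have OP a b : P a -> P b -> O a -> O b -> a = b.
  move=> Pa Pb [v hv Tva] [w hw Twb].
  have [Av _] := hv; have [Aw _] := hw.
  case: (above_nest hv hw) => [vw|Tvw|Twv].
  - by subst w; exact: (TP Av).
  - by apply: (TP Av) => //; apply: (nest Av Tvw).2; left.
  - by apply: (TP Aw) => //; apply: (nest Aw Twv).2; left.
(* Since [O] is open, a connected set through [u] can leave it only at a boundary point. *)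
have clO B : connected B -> B `<=` A -> B u -> (forall b, B b -> closure O b -> O b) ->
    B `<=` O.
  move=> cB BA Bu h.
  have [|||//|k] := @connected_open_split _ B O (~` closure O) cB oO.
  - by apply: closed_openC; exact: closed_closure.
  - move=> x Bx; have [Ox|nOx] := pselect (O x); first by left.
    by right => /(h _ Bx).
  - by apply/seteqP; split => // x [_ [/subset_closure]].
  - by exfalso; apply: (k _ Bu); exact: subset_closure.
have [b [Ab cOb nOb]] : exists b, [/\ A b, closure O b & ~ O b].
  apply: contrapT => h; have [a [a' [Pa Pa' naa _ _]]] := SP Au.
  apply: naa; apply: OP => //; apply: (clO A cA) => //.
  - by move=> b Ab cb; apply: contrapT => nOb; apply: h; exists b.
  - exact: PA.
  - by move=> b Ab cb; apply: contrapT => nOb; apply: h; exists b.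
  - exact: PA.
have Tb x v : above u v -> A x -> ~ O x -> S v x.
  move=> hv Ax nOx; have [Av _] := hv; case: (cutP (cutST Av) Ax) => // [xv|Tx].
    by exfalso; apply: nOx; rewrite xv; exact: chO.
  by exfalso; apply: nOx; exists v.
(* A connected set that joins a point outside [O] to a point beyond the chain element [v] passes
   through [v]. *)
have meet x N : A x -> ~ O x -> connected N -> N `<=` A -> N x -> forall y v,
    above u v -> T v y -> N y -> N v.
  move=> Ax nOx cN NA Nx y v hv Tvy Ny; apply: contrapT => nNv.
  have [Av _] := hv.
  apply: (cut_same (cutST Av) cN _ Nx Ny (Tb _ _ hv Ax nOx) Tvy).
  by move=> z Nz; split; [exact: NA|move=> /= zv; apply: nNv; rewrite -zv].
have Sbu : S b u.
  case: (cutP (cutST Ab) Au) => // [ub|Tbu]; exfalso; apply: nOb.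
    by rewrite -ub.
  by apply: chO; split => //; right.
have Sbv v : above u v -> S b v.
  move=> hv; have [Av uv] := hv.
  case: (cutP (cutST Ab) Av) => // [vb|Tbv]; exfalso; apply: nOb.
    by rewrite -vb; exact: chO.
  apply: chO; split => //; right; apply: (nest Ab Tbv).2.
  by case: uv => [->|]; [right|left].
have [a [a' [Pa Pa' naa Sa Sa']]] := SP Ab.
have SbO : S b `<=` O.
  apply: (clO _ (cut_cS (cutST Ab))) => //.
    by move=> x /(cut_subS (cutST Ab)) [].
  move=> b' Sbb' cOb'; apply: contrapT => nOb'.
  have [Ab' b'b] := cut_subS (cutST Ab) Sbb'.
  move: hX; rewrite open_hausdorff => /(_ b b') [|[W W'] /=].
    by apply/eqP => bb'; apply: b'b.
  rewrite !inE => -[Wb W'b'] [oW oW' dW].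
  have [N [oN cN Nb NW]] := lX (openI oA oW) (conj Ab Wb).
  have [N' [oN' cN' N'b NW']] := lX (openI oA oW') (conj Ab' W'b').
  have [y [Oy Ny]] := cOb _ (open_nbhs_nbhs (conj oN Nb)).
  have [y' [Oy' Ny']] := cOb' _ (open_nbhs_nbhs (conj oN' N'b)).
  have {Oy} [v hv Tvy] := Oy; have {Oy'} [v' hv' Tvy'] := Oy'.
  (* The larger of [v] and [v'] in the chain; the disjoint neighborhoods [N] and [N'] would both
     have to contain it. *)
  have [w hw [Ty Ty']] : exists2 w, above u w & T w y /\ T w y'.
    have [Av _] := hv; have [Av' _] := hv'.
    case: (above_nest hv hv') => [vv|Tvv|Tvv].
    - by exists v => //; rewrite {2}vv.
    - by exists v => //; split => //; apply: (nest Av Tvv).2; left.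
    - by exists v' => //; split => //; apply: (nest Av' Tvv).2; left.
  have Nw : N w.
    by apply: (meet b N Ab nOb cN _ Nb y) => // x /NW [].
  have N'w : N' w.
    by apply: (meet b' N' Ab' nOb' cN' _ N'b y') => // x /NW' [].
  exact: (disjointE dW (NW _ Nw).2 (NW' _ N'w).2).
by apply: naa; apply: OP => //; exact: SbO.
Qed.

Let max_disj e e' : maxs e -> maxs e' -> e <> e' -> T e `|` [set e] `<=` S e'.
Proof.
move=> [Ae me] [Ae' me'] ee'; apply: disj => //.
  case: (cutP (cutST Ae) Ae') => // [e'e|Tee]; first by have := ee' (esym e'e).
  by have := me' _ Ae Tee.
case: (cutP (cutST Ae') Ae) => // Tee.
by have := me _ Ae' Tee.
Qed.

(** Every point of [A] lies at or beyond exactly one maximal point, which defines a retraction [r]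
    onto [maxs]. Continuity of [r] makes [maxs] connected, and the disjoint open far sides make it
    countable. Once [maxs] is a single point, the points on its near side have no value of [r]
    left. *)
Lemma no_branching : A !=set0 -> False.
Proof.
move=> [u0 Au0].
have [r hr] : {r : X -> X & forall u, A u -> maxs (r u) /\ (r u = u \/ T (r u) u)}.
  apply: (choice (P := fun u e => A u -> maxs e /\ (e = u \/ T e u))) => u.
  have [Au|nA] := pselect (A u); last by exists u.
  by have [e me eu] := exists_max Au; exists e.
have uniq e u : maxs e -> e = u \/ T e u -> r u = e.
  move=> me eu; have [Ae _] := me.
  have Au : A u by case: eu => [<-//|/(cut_subT (cutST Ae))[]].
  have [mr ru] := hr _ Au; apply: contrapT => ne.
  have [Ar _] := mr.
  have k : S e u by apply: (max_disj mr me ne); case: ru => [->|]; [right|left].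
  case: eu => [eu|]; last exact: (TS Ae k).
  by have [_ /(_ (esym eu))] := cut_subS (cutST Ae) k.
have cE : connected maxs.
  apply: connected_openP => U V oU oV EUV dUV.
  have oR W : open W -> open (A `&` r @^-1` W).
    move=> oW; rewrite openE => u [Au /= Wr].
    have [mr ru] := hr _ Au; have [Ar _] := mr.
    case: ru => [ru|Tu].
      have [N [oN cN Nu NW]] := lX (openI oA oW) (conj Ar Wr).
      rewrite /interior -ru; apply: filterS (open_nbhs_nbhs (conj oN Nu)) => w Nw.
      have Aw : A w by case: (NW _ Nw).
      split => //=; have [mw rw] := hr _ Aw.
      have [<-//|ne] := pselect (r u = r w).
      case: rw => [->|Tw]; first exact: (NW _ Nw).2.
      (* [r w] separates [w] from the maximal point [r u], so the connected set [N] contains it. *)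
      suff : N (r w) by move=> /NW[].
      apply: contrapT => nN; have [Arw _] := mw.
      apply: (cut_same (cutST Arw) cN _ Nu Nw _ Tw).
        by move=> z Nz; split; [exact: (NW _ Nz).1|move=> /= zr; apply: nN; rewrite -zr].
      by apply: (max_disj mr mw ne); right.
    apply: filterS (open_nbhs_nbhs (conj (cut_oT (cutST Ar)) Tu)) => w Tw.
    split; first by case: (cut_subT (cutST Ar) Tw).
    by rewrite /= (uniq (r u)) //; right.
  have [||||k|k] := @connected_open_split _ A (A `&` r @^-1` U) (A `&` r @^-1` V) cA.
  - exact: oR.
  - exact: oR.
  - by move=> u Au; have [/EUV[]] := hr _ Au; [left|right].
  - apply/seteqP; split => // u [Au [[_ /= Uu] [_ /= Vu]]].
    by apply: (disjointE dUV (x := r u)) => //; have [] := hr _ Au.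
  - left=> e me; have [Ae _] := me; have [_ /=] := k _ Ae.
    by rewrite (uniq e) //; left.
  - right=> e me; have [Ae _] := me; have [_ /=] := k _ Ae.
    by rewrite (uniq e) //; left.
have ctE : countable maxs.
  have [n hn] : {n : X -> nat & forall e, maxs e -> T e (d (n e))}.
    apply: (choice (P := fun e n => maxs e -> T e (d n))) => e.
    have [me|nm] := pselect (maxs e); last by exists 0%N.
    have [Ae _] := me.
    have [n] := dd (cut_oT (cutST Ae)) (cut_T0 (cutST Ae)).
    by exists n.
  apply/countable_injP; exists n => e e'; rewrite !inE => me me' nn.
  apply: contrapT => ne; have [Ae' _] := me'.
  apply: (TS Ae' (x := d (n e'))); last exact: (hn _ me').
  by apply: (max_disj me me' ne); left; rewrite -nn; exact: (hn _ me).
have [mr _] := hr _ Au0; have [Ar _] := mr.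
have one e : maxs e -> e = r u0.
  move=> me; apply: (lightF cE) => // z mz.
  apply: (@countable_connected_subsingleton _ (F @` maxs) _ (F (r u0))).
  - by apply: sub_countable ctE; exact: card_image_le.
  - by apply: connected_continuous_connected => //; exact: continuous_subspaceT.
  - by exists z.
  - by exists (r u0).
have [s Ss] := cut_S0 (cutST Ar).
have [As sr] := cut_subS (cutST Ar) Ss.
have [ms [rs|]] := hr _ As; first by apply: sr; rewrite -rs; exact: one.
by rewrite (one _ ms); exact: (TS Ar Ss).
Qed.

End no_branching.

(** If none of the points separates the other two, every cut of [A] has a side with at least two of
    them. This majority side is taken as [S], and two majorities among three points always share
    one, as [no_branching] requires. *)
Lemma three_points x y z : A x -> A y -> A z -> x <> y -> y <> z -> x <> z ->
  [\/ separates A x y z, separates A y x z | separates A z x y].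
Proof.
move=> Ax Ay Az xy yz xz; apply: contrapT => h.
have sx : ~ separates A x y z by move=> k; apply: h; constructor 1.
have sy : ~ separates A y x z by move=> k; apply: h; constructor 2.
have sz : ~ separates A z x y by move=> k; apply: h; constructor 3.
pose P := [set x; y; z].
pose two (B : set X) := [\/ B x /\ B y, B y /\ B z | B x /\ B z].
have twoP B : two B -> exists a b, [/\ P a, P b, a <> b, B a & B b].
  rewrite /P; case=> -[Ba Bb].
  - by exists x, y; split => //; [left; left|left; right].
  - by exists y, z; split => //; [left; right|right].
  - by exists x, z; split => //; [left; left|right].
have P2 B C a b : two B -> B `&` C = set0 -> P a -> P b -> C a -> C b -> a = b.
  move=> tB dB Pa Pb Ca Cb.
  have nB u : C u -> ~ B u by move=> Cu Bu; exact: (disjointE dB Bu Cu).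
  move: Pa Pb => [[|]|] /= ea [[|]|] /= eb; subst a b => //; exfalso;
    by case: tB => -[B1 B2]; first [exact: (nB _ Ca)|exact: (nB _ Cb)].
have cutex u : A u -> exists2 S, two S & exists T, cut2 A u S T.
  move=> Au; have [_ _ _ /(_ _ Au) [S [T hST]]] := cylA.
  have hTS := cut_sym hST.
  suff [tS|tT] : two S \/ two T by [exists S => //; exists T|exists T => //; exists S].
  have nx S' T' : cut2 A x S' T' -> S' y -> T' z -> False.
    by move=> k Sy Tz; apply: sx; exists S', T'.
  have ny S' T' : cut2 A y S' T' -> S' x -> T' z -> False.
    by move=> k Sy Tz; apply: sy; exists S', T'.
  have nz S' T' : cut2 A z S' T' -> S' x -> T' y -> False.
    by move=> k Sy Tz; apply: sz; exists S', T'.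
  case: (cutP hST Ax) => [xu|Sx|Tx]; case: (cutP hST Ay) => [yu|Sy|Ty];
    case: (cutP hST Az) => [zu|Sz|Tz]; rewrite /two;
    first [by left; constructor 1|by left; constructor 2|by left; constructor 3
          |by right; constructor 1|by right; constructor 2|by right; constructor 3|exfalso];
    subst u; first [exact: (nx _ _ hST)|exact: (nx _ _ hTS)
      |exact: (ny _ _ hST)|exact: (ny _ _ hTS)|exact: (nz _ _ hST)|exact: (nz _ _ hTS)
      |exact: xy|exact: yz|exact: xz|idtac].
have [ST hST] : {ST : X -> set X * set X &
    forall u, A u -> two (ST u).1 /\ cut2 A u (ST u).1 (ST u).2}.
  apply: (choice (P := fun u ST => A u -> two ST.1 /\ cut2 A u ST.1 ST.2)) => u.
  have [Au|nA] := pselect (A u); last by exists (set0, set0).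
  by have [S tS [T k]] := cutex _ Au; exists (S, T).
apply: (@no_branching P (fun u => (ST u).1) (fun u => (ST u).2)).
- by move=> _ [[|]|] ->.
- by move=> u /hST[].
- by move=> u /hST[/twoP].
- move=> u a b /hST[tS k] Pa Pb Ta Tb.
  by apply: (P2 _ _ _ _ tS (cut_d k)).
- move=> u v /hST[tu _] /hST[tv _].
  by case: tu => -[B1 B2]; case: tv => -[B3 B4];
    first [by exists x|by exists y|by exists z].
- by exists x.
Qed.

End three_points.

(** * Half of a cylindrical set is a ray *)

Section weighted_sum.
Context {R : realType}.
Implicit Types (x y : nat -> R) (K e : R).

Let psum x N : R := \sum_(n < N) x n / 2 ^+ n.

(** The series with terms [x n / 2 ^+ n], taken as a supremum of partial sums: for the bounded
    non-negative sequences to which it is applied this is the sum, and comparison of partial sums is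
    all that is needed. *)
Definition wsum x : R := sup (range (psum x)).

Let psum_le x y e N : (forall n, x n <= y n + e) -> 0 <= e ->
  psum x N <= psum y N + 2 * e.
Proof.
(* The factor of [e] is the partial geometric sum of the weights; the constant 2 alone would not
   pass through the induction. *)
move=> xy e0; suff : psum x N <= psum y N + (2 - 2 / 2 ^+ N) * e.
  move=> /le_trans; apply; rewrite lerD2l ler_wpM2r // lerBlDr lerDl.
  by rewrite divr_ge0 // exprn_ge0.
rewrite /psum; elim: N => [|N IH].
  by rewrite !big_ord0 expr0 divr1 subrr mul0r addr0.
rewrite !big_ord_recr /=.
have h : x N / 2 ^+ N <= y N / 2 ^+ N + e / 2 ^+ N.
  by rewrite -mulrDl ler_wpM2r // invr_ge0 exprn_ge0.
apply: le_trans (lerD IH h) _.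
rewrite addrACA lerD2l exprS invfM.
set z := (2 ^+ N)^-1; rewrite le_eqVlt; apply/orP; left; apply/eqP; lra.
Qed.

Let psum_ub x K : 0 <= K -> (forall n, x n <= K) -> ubound (range (psum x)) (2 * K).
Proof.
move=> K0 xK _ [N _ <-]; have := @psum_le x (fun=> 0) K N.
rewrite {2}/psum big1 ?add0r => [|i _]; last by rewrite mul0r.
by apply=> // n; rewrite add0r.
Qed.

Lemma wsum_ub x K : 0 <= K -> (forall n, x n <= K) -> wsum x <= 2 * K.
Proof.
move=> K0 xK; apply: ge_sup; first by exists (psum x 0%N), 0%N.
exact: psum_ub.
Qed.

Lemma wsum_le x y K e : 0 <= K -> (forall n, y n <= K) ->
  (forall n, x n <= y n + e) -> 0 <= e -> wsum x <= wsum y + 2 * e.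
Proof.
move=> K0 yK xy e0; apply: ge_sup; first by exists (psum x 0%N), 0%N.
move=> _ [N _ <-]; apply: le_trans (psum_le N xy e0) _; rewrite lerD2r.
apply: ub_le_sup; first by exists (2 * K); exact: psum_ub.
by exists N.
Qed.

Lemma wsum_lt x y K i : 0 <= K -> (forall n, 0 <= x n) -> (forall n, y n <= K) ->
  (forall n, x n <= y n) -> x i < y i -> wsum x < wsum y.
Proof.
(* A supremum loses strict inequalities, so the gain in the term [i] is kept as one gap [e] valid
   for all partial sums. *)
move=> K0 x0 yK xy xyi; pose e := (y i - x i) / 2 ^+ i.
have e0 : 0 < e by rewrite divr_gt0 ?subr_gt0 // exprn_gt0.
suff : wsum x <= wsum y - e by move=> /le_lt_trans; apply; lra.
apply: ge_sup; first by exists (psum x 0%N), 0%N.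
move=> _ [N _ <-]; rewrite lerBrDr.
pose M := maxn N i.+1.
apply: (@le_trans _ _ (psum y M)); last first.
  apply: ub_le_sup; first by exists (2 * K); exact: psum_ub.
  by exists M.
have iM : (i < M)%N by rewrite leq_max leqnn orbT.
have NM : psum x N <= psum x M.
  rewrite /psum -(@big_mkord _ _ _ N xpredT (fun n => x n / 2 ^+ n)).
  rewrite -(@big_mkord _ _ _ M xpredT (fun n => x n / 2 ^+ n)).
  rewrite [leRHS](@big_cat_nat _ _ _ N) ?leq_maxl //= lerDl.
  by apply: sumr_ge0 => n _; rewrite divr_ge0 // exprn_ge0.
apply: (le_trans (lerD NM (lexx e))).
rewrite /psum (bigD1 (Ordinal iM)) // [leRHS](bigD1 (Ordinal iM)) //=.
rewrite addrAC lerD //.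
  by rewrite /e mulrBl addrC subrK.
by apply: ler_sum => n _; rewrite ler_wpM2r // invr_ge0 exprn_ge0.
Qed.

End weighted_sum.

Section half_arc.
Context {R : realType} {X : topologicalType}.
Hypotheses (hX : hausdorff_space X) (lX : locally_connected X).
Variables (d : nat -> X) (F : X -> R) (K : R).
Hypotheses (dd : dense_seq d) (cF : continuous F) (FK : forall x, `|F x| <= K).
Hypothesis lightF : forall (B : set X) t, connected B ->
  (forall z, B z -> F z = t) -> forall z w, B z -> B w -> z = w.
Variable A : set X.
Hypothesis cylA : cyl A.
Let oA : open A. Proof. by case: cylA. Qed.
Let cA : connected A. Proof. by case: cylA. Qed.
Variables (c : X) (L Q : set X).
Hypotheses (Ac : A c) (cutc : cut2 A c L Q).
Let H : set X := Q `|` [set c].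

(** * The order of a half: [T u v] means that [v] lies beyond [u] as seen from [c] *)

Section order.
Variables S T : X -> set X.
Hypothesis hcut : forall u, H u -> cut2 A u (S u) (T u).
Hypothesis Tc : T c = Q.
Hypothesis Sc : forall u, H u -> u <> c -> S u c.

Let Hc : H c. Proof. by right. Qed.
Let HA : H `<=` A.
Proof. by move=> u [/(cut_subT cutc)[]|->]. Qed.
Let HQ u : H u -> u <> c -> Q u. Proof. by case. Qed.
Let TS u x : H u -> S u x -> T u x -> False.
Proof. by move=> Hu; exact: (disjointE (cut_d (hcut Hu))). Qed.
Let Tir u : H u -> T u u -> False.
Proof. by move=> Hu /(cut_subT (hcut Hu))[]. Qed.

Let SS u v : H u -> H v -> S u `&` S v !=set0.
Proof.
have aux w : H w -> S c `&` S w !=set0.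
  move=> Hw; have [->|wc] := pselect (w = c).
    by rewrite setIid; exact: cut_S0 (hcut Hc).
  have [s Ss] := cut_S0 (hcut Hc); exists s; split => //.
  apply: (cut_disj oA cA Ac (cut_sym (hcut Hc)) (hcut Hw)).
  - by rewrite Tc; exact: HQ.
  - exact: Sc.
  - by left.
move=> Hu Hv; have [->|uc] := pselect (u = c); first exact: aux.
have [->|vc] := pselect (v = c); first by rewrite setIC; exact: aux.
by exists c; split; exact: Sc.
Qed.

Let TQ u : H u -> T u `<=` Q.
Proof.
move=> Hu; have [->|uc] := pselect (u = c); first by rewrite Tc.
have Tcu : T c u by rewrite Tc; exact: HQ.
have [_ h] := cut_nest oA cA Ac (hcut Hc) (hcut Hu) (SS Hc Hu) Tcu.
by rewrite -Tc => x Tx; apply: h; left.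
Qed.

Let TH u v : H u -> T u v -> H v. Proof. by move=> /TQ h /h; left. Qed.

Let nest u v : H u -> T u v ->
  S u `|` [set u] `<=` S v /\ T v `|` [set v] `<=` T u.
Proof.
move=> Hu Tuv; have Hv := TH Hu Tuv.
by apply: (cut_nest oA cA (HA Hu) (hcut Hu) (hcut Hv)) => //; exact: SS.
Qed.

Let asym u v : H u -> T u v -> T v u -> False.
Proof.
move=> Hu Tuv; have [h _] := nest Hu Tuv.
by apply: TS; [exact: TH Tuv|apply: h; right].
Qed.

Let trans u v w : H u -> T u v -> T v w -> T u w.
Proof. by move=> Hu Tuv Tvw; apply: (nest Hu Tuv).2; left. Qed.

(** Apply [three_points] to [c], [u] and [v]. The point [c] does not separate the other two, as both
    lie in the connected set [Q]; if [u] separates [c] from [v], then [v] is beyond [u], and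
    symmetrically. *)
Let tri u v : H u -> H v -> u <> v -> T u v \/ T v u.
Proof.
move=> Hu Hv uv; have [uc|uc] := pselect (u = c).
  by left; rewrite uc Tc; apply: HQ => //; rewrite -uc; exact/nesym.
have [vc|vc] := pselect (v = c).
  by right; rewrite vc Tc; apply: HQ.
have side w x : H w -> H x -> w <> c -> x <> w -> separates A w c x -> T w x.
  move=> Hw Hx wc xw [S' [T' [k S'c T'x]]].
  case: (cutP (hcut Hw) (HA Hx)) => // Swx; exfalso.
  apply: (cut_same k (cut_cS (hcut Hw)) _ (Sc Hw wc) Swx S'c T'x).
  by move=> y /(cut_subS (hcut Hw))[].
case: (three_points hX lX dd cF lightF cylA (HA Hc) (HA Hu) (HA Hv) (nesym uc) uv (nesym vc)).
- move=> [S' [T' [k S'u T'v]]]; exfalso.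
  apply: (cut_same k (cut_cT cutc) _ (HQ Hu uc) (HQ Hv vc) S'u T'v).
  by move=> y /(cut_subT cutc)[].
- by left; apply: side => //; exact/nesym.
- by right; apply: side.
Qed.

Let convex N a u b : connected N -> N `<=` A -> N a -> N b -> H a ->
  T a u -> T u b -> N u.
Proof.
move=> cN NA Na Nb Ha Tau Tub; apply: contrapT => nNu.
have Hu := TH Ha Tau.
apply: (cut_same (hcut Hu) cN _ Na Nb) => //.
  by move=> y Ny; split; [exact: NA|move=> /= yu; apply: nNu; rewrite -yu].
by apply: (nest Ha Tau).1; right.
Qed.

Let le u v := u = v \/ T u v.

Let le_trans' u v w : H u -> le u v -> le v w -> le u w.
Proof.
move=> Hu [->//|Tuv] [<-|Tvw]; first by right.
by right; exact: trans Tvw.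
Qed.

Let le_anti u v : H u -> le u v -> T v u -> False.
Proof. by move=> Hu [<-|Tuv]; [exact: Tir|exact: asym]. Qed.

(** A splitting of the segment extends to the connected set of all points at or beyond [p]: whatever
    lies beyond [v] joins the part that contains [v]. *)
Let seg_connected p v : H p -> T p v -> connected [set w | le p w /\ le w v].
Proof.
move=> Hp Tpv; have Hv := TH Hp Tpv.
set I := [set w | _].
have aux U V : open U -> open V -> I `<=` U `|` V -> I `&` (U `&` V) = set0 ->
    V v -> I `<=` V.
  move=> oU oV IUV dis Vv.
  have cP := cut_conn oA cA (HA Hp) (cut_sym (hcut Hp)).
  have Iw w : (T p `|` [set p]) w -> S v w -> I w.
    move=> Pw Svw; split; first by case: Pw => [Tpw|->]; [right|left].
    have Hw : H w by case: Pw => [/(TH Hp)|->].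
    have [->|wv] := pselect (w = v); first by left.
    by case: (tri Hw Hv wv) => [|/(TS Hv Svw)//]; right.
  have [||||k|k] := @connected_open_split _ _ (U `&` S v) (V `|` T v) cP.
  - by apply: openI => //; exact: cut_oS (hcut Hv).
  - by apply: openU => //; exact: cut_oT (hcut Hv).
  - move=> w Pw; have Aw : A w.
      by case: Pw => [/(cut_subT (hcut Hp))[]|->] //; exact: HA.
    case: (cutP (hcut Hv) Aw) => [->|Svw|Tvw]; [by right; left| |by right; right].
    by have [Uw|Vw] := IUV w (Iw _ Pw Svw); [left|right; left].
  - apply/seteqP; split => // w [Pw [[Uw Svw] [Vw|/(TS Hv Svw)//]]].
    by apply: (disjointE dis (x := w)) => //; exact: Iw.
  - have [_ Svv] : (U `&` S v) v by apply: k; left.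
    by have [] := cut_subS (hcut Hv) Svv.
  - move=> w [pw wv].
    have [|//|Tvw] := k w; first by case: pw => [<-|]; [right|left].
    exfalso; apply: (le_anti _ wv Tvw).
    by case: pw => [<-//|/(TH Hp)].
have Iv : I v by split; [right|left].
apply: connected_openP => U V oU oV IUV dis.
have [Uv|Vv] := IUV v Iv; last by right; exact: aux dis Vv.
left; apply: (aux V U) => //; first by rewrite setUC.
by rewrite [V `&` U]setIC.
Qed.

(** The value 0 keeps the set non-empty; its supremum is then 0 at points before [d n], and also
    when [d n] is not in [H]. *)
Let osc n z : set R := [set y | y = 0 \/ exists w,
  [/\ H (d n), le (d n) w, le w z & y = `|F w - F (d n)|]].

Let g n z : R := sup (osc n z).

Let K0 : 0 <= K. Proof. by apply: le_trans (FK c); exact: normr_ge0. Qed.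

Let osc_ub n z : ubound (osc n z) (2 * K).
Proof.
move=> y [->|[w [_ _ _ ->]]]; first by rewrite mulr_ge0 // K0.
apply: le_trans (ler_normB _ _) _; have := FK w; have := FK (d n); lra.
Qed.

Let g_ub n z y : osc n z y -> y <= g n z.
Proof. by move=> h; apply: ub_le_sup => //; exists (2 * K); exact: osc_ub. Qed.

Let g_le n z y : ubound (osc n z) y -> g n z <= y.
Proof. by move=> h; apply: ge_sup => //; exists 0; left. Qed.

Let g0 n z : 0 <= g n z. Proof. by apply: g_ub; left. Qed.

Let gK n z : g n z <= 2 * K. Proof. by apply: g_le; exact: osc_ub. Qed.

Let g_mono n u v : T u v -> g n u <= g n v.
Proof.
move=> Tuv; apply: g_le => y [->|[w [Hd dw wu ->]]]; first exact: g0.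
have Hw : H w by case: dw => [<-//|/(TH Hd)].
apply: g_ub; right; exists w; split => //.
by apply: le_trans' wu _ => //; right.
Qed.

(** By density some [d n] lies strictly between [u] and [v]. For it [g n u] is 0, while [g n v] is
    positive: otherwise [F] would be constant on the connected segment from [d n] to [v]. *)
Let g_strict u v : H u -> T u v -> exists n, g n u < g n v.
Proof.
move=> Hu Tuv; have Hv := TH Hu Tuv.
have [] := dd (openI (cut_oT (hcut Hu)) (cut_oS (hcut Hv))).
  have [w Tuw Svw] := cut_nbhd oA cA (HA Hv) (hcut Hv) (cut_oT (hcut Hu)) Tuv.
  by exists w.
move=> n [Tud Svd]; exists n; have Hd := TH Hu Tud.
have Tdv : T (d n) v.
  have dv : d n <> v by case: (cut_subS (hcut Hv) Svd).
  by case: (tri Hd Hv dv) => // /(TS Hv Svd).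
have -> : g n u = 0.
  apply/eqP; rewrite eq_le g0 andbT; apply: g_le => y [->//|[w [_ dw wu _]]].
  by exfalso; apply: (le_anti Hd (le_trans' Hd dw wu) Tud).
have [w [[dw wv] Fw]] : exists w, (le (d n) w /\ le w v) /\ F w <> F (d n).
  apply: contrapT => h; apply: (Tir Hd).
  have {2}-> // : d n = v.
  apply: (lightF (t := F (d n)) (seg_connected Hd Tdv)).
  - by move=> z hz; apply: contrapT => Fz; apply: h; exists z.
  - by split; [left|right].
  - by split; [right|left].
apply: lt_le_trans (g_ub (y := `|F w - F (d n)|) _).
  by rewrite normr_gt0 subr_eq0; exact/eqP.
by right; exists w.
Qed.

(** Equicontinuity: one neighborhood must serve all [n] for the weighted sum to be continuous. A
    connected [N] on which [F] varies by at most [e] contains all points between two of its members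
    in [H], so moving from one to the other changes no [g n] by more than [e]. *)
Let g_equi z0 e : H z0 -> 0 < e -> exists N, [/\ open N, N z0 &
  forall z n, N z -> H z -> g n z <= g n z0 + e /\ g n z0 <= g n z + e].
Proof.
move=> Hz0 e0.
have oF : open (A `&` F @^-1` ball (F z0) (e / 2)).
  by apply: openI => //; apply: open_comp => [u _|]; [exact: cF|exact: ball_open].
have [|N [oN cN Nz0 NF]] := lX oF (x := z0).
  by split; [exact: HA|apply: ballxx; rewrite divr_gt0].
have NA : N `<=` A by move=> x /NF[].
have NN u v : N u -> N v -> `|F u - F v| <= e.
  move=> /NF[_ /=]; rewrite /ball /= => h1 /NF[_ /=]; rewrite /ball /= => h2.
  have := ler_distD (F z0) (F u) (F v); rewrite distrC in h1; lra.
have key n u v : H u -> N u -> N v -> T u v -> g n v <= g n u + e.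
  move=> Hu Nu Nv Tuv; apply: g_le => y [->|[w [Hd dw wv ->]]].
    by rewrite addr_ge0 // ltW.
  have Hw : H w by case: dw => [<-//|/(TH Hd)].
  have [uw|Tuw] : le w u \/ T u w.
    have [->|wu] := pselect (w = u); first by left; left.
    by have [] := tri Hw Hu wu; [left; right|right].
    by apply: ler_wpDr; [exact: ltW|apply: g_ub; right; exists w].
  have Nw : N w by case: wv => [->//|Twv]; exact: (convex cN NA Nu Nv Hu Tuw Twv).
  have [du|Tud] : le (d n) u \/ T u (d n).
    have [->|du] := pselect (d n = u); first by left; left.
    by have [] := tri Hd Hu du; [left; right|right].
  - have : `|F u - F (d n)| <= g n u by apply: g_ub; right; exists u; split => //; left.
    have := ler_distD (F u) (F w) (F (d n)); have := NN _ _ Nw Nu; lra.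
  - apply: ler_wpDl => //; apply: NN => //.
    by case: dw => [->//|Tdw]; exact: (convex cN NA Nu Nw Hu Tud Tdw).
exists N; split => // z n Nz Hz.
have [->|zz] := pselect (z = z0); first by split; rewrite lerDl ltW.
by case: (tri Hz Hz0 zz) => k; (split; last by apply: key) ||
   (split; first by apply: key); apply: ler_wpDr; [exact: ltW|exact: g_mono|exact: ltW|exact: g_mono].
Qed.

Let phi z : R := wsum (g^~ z).

Let K20 : 0 <= 2 * K. Proof. by rewrite mulr_ge0 // K0. Qed.

Let phi_lt u v : H u -> T u v -> phi u < phi v.
Proof.
move=> Hu Tuv; have [n gn] := g_strict Hu Tuv.
by apply: (wsum_lt (i := n) K20) => // k; exact: g_mono.
Qed.

Let phi_ltE u v : H u -> H v -> phi u < phi v -> T u v.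
Proof.
move=> Hu Hv uv; have [uv'|ne] := pselect (u = v).
  by move: uv; rewrite uv' ltxx.
case: (tri Hu Hv ne) => // Tvu.
by have := lt_trans uv (phi_lt Hv Tvu); rewrite ltxx.
Qed.

Let phi_inj u v : H u -> H v -> phi u = phi v -> u = v.
Proof.
move=> Hu Hv uv; apply: contrapT => ne.
by case: (tri Hu Hv ne) => [/(phi_lt Hu)|/(phi_lt Hv)]; rewrite uv ltxx.
Qed.

Let phi_cts : {within H, continuous phi}.
Proof.
apply/subspace_continuousP => z0 Hz0; apply/cvgrPdist_le => e e0.
have e40 : 0 < e / 2 by rewrite divr_gt0.
have [N [oN Nz0 h]] := g_equi Hz0 e40.
rewrite near_withinE; apply: filterS (open_nbhs_nbhs (conj oN Nz0)) => z Nz Hz.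
rewrite ler_distl; have e2 : e = 2 * (e / 2) by lra.
apply/andP; split.
  rewrite lerBlDr {1}e2; apply: (wsum_le K20) => [n|n|]; [exact: gK| |exact: ltW].
  by case: (h z n Nz Hz).
rewrite {1}e2; apply: (wsum_le K20) => [n|n|]; [exact: gK| |exact: ltW].
by case: (h z n Nz Hz).
Qed.

(** The parametrization [a] inverts [phi], which maps the connected set [H] onto an interval. The
    supremum [be] is not attained, because every point of [H] has points beyond it. The near sides
    [S (a s)] are the open sets of the last clause. *)
Lemma half_arc_order : exists (a : R -> X) (al be : R),
  [/\ al < be, {within `[al, be[, continuous a}, {in `[al, be[ &, injective a},
      a @` `[al, be[ = H & a al = c /\ forall s, al < s < be ->
      exists2 W, open W & W `&` H = a @` `[al, s[].
Proof.
have iJ : is_interval (phi @` H).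
  apply/connected_intervalP; apply: connected_continuous_connected phi_cts.
  exact: (cut_conn oA cA Ac (cut_sym cutc)).
pose al := phi c; pose be := sup (phi @` H).
have JS : has_sup (phi @` H).
  split; first by exists al, c.
  exists (2 * (2 * K)) => _ [z _ <-]; exact: wsum_ub.
have phi_al z : H z -> al <= phi z.
  move=> Hz; have [->//|zc] := pselect (z = c).
  by apply/ltW/phi_lt => //; rewrite Tc; exact: HQ.
have phi_be z : H z -> phi z < be.
  move=> Hz; have [w Tw] := cut_T0 (hcut Hz).
  apply: lt_le_trans (phi_lt Hz Tw) _; apply: ub_le_sup; first by case: JS.
  by exists w => //; exact: TH Tw.
have [a ha] : {a : R -> X & forall s, al <= s < be -> H (a s) /\ phi (a s) = s}.
  apply: (choice (P := fun s z => al <= s < be -> H z /\ phi z = s)) => s.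
  have [/andP[als sbe]|ns] := boolP (al <= s < be); last by exists c.
  have [_ [w Hw <-] sw] := sup_gt JS.1 sbe.
  have [|z Hz zs] := iJ _ _ (imageP phi Hc) (imageP phi Hw) s; first by rewrite als ltW.
  by exists z.
have aphi z : H z -> a (phi z) = z.
  move=> Hz; have [|Ha e] := ha (phi z); first by rewrite phi_al // phi_be.
  exact: phi_inj.
have aH s : al <= s < be -> H (a s) by case/ha.
have pa s : al <= s < be -> phi (a s) = s by case/ha.
exists a, al, be; split.
- exact: phi_be.
- apply/subspace_continuousP => s0 /=; rewrite in_itv /= => hs0.
  move=> O; rewrite nbhsE => -[ W [oW Wa] WO].
  have Ha := aH _ hs0; set z0 := a s0 in Wa Ha *.
  have [N [oN cN Nz0 NO]] := lX (openI oA oW) (conj (HA Ha) Wa).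
  have NA : N `<=` A by move=> x /NO[].
  have [z2 Nz2 Tz2] := cut_nbhd oA cA (HA Ha) (cut_sym (hcut Ha)) oN Nz0.
  (* A point [z1] of [N] before [a s0] bounds nearby values from below. Nothing comes before [c], so
     there [c] itself is taken, with the arbitrary margin 1. *)
  have [lo lo0 [z1 [Nz1 Hz1 hlo]]] : exists2 lo, lo < s0 & exists z1,
      [/\ N z1, H z1 & forall s, al <= s < be -> lo < s -> le z1 (a s)].
    have [z0c|z0c] := pselect (z0 = c).
      exists (s0 - 1); [lra|exists z0; split => // s hs _].
      have [->|ne] := pselect (z0 = a s); first by left.
      right; rewrite z0c Tc; apply: HQ; first exact: aH.
      by move=> ac; apply: ne; rewrite z0c.
    have [z1 [Nz1 Qz1] Sz1] := cut_nbhd oA cA (HA Ha) (hcut Ha)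
      (openI oN (cut_oT cutc)) (conj Nz0 (HQ Ha z0c)).
    have Hz1 : H z1 by left.
    have Tz1 : T z1 z0.
      have ne : z1 <> z0 by case: (cut_subS (hcut Ha) Sz1).
      by case: (tri Hz1 Ha ne) => // /(TS Ha Sz1).
    exists (phi z1); first by rewrite -(pa _ hs0); exact: phi_lt.
    exists z1; split => // s hs z1s; right; apply: phi_ltE => //; first exact: aH.
    by rewrite pa.
  have up : s0 < phi z2 by rewrite -{1}(pa _ hs0); exact: phi_lt.
  have nI : nbhs s0 [set` `]lo, phi z2[].
    by apply: open_nbhs_nbhs; split; [exact: interval_open|rewrite /= in_itv /= lo0].
  rewrite /= nbhs_simpl /= /within /=.
  apply: filterS nI => s; rewrite /= !in_itv /= => /andP[los sz2] hs.
  apply: WO; suff : N (a s) by move=> /NO[].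
  case: (hlo s hs los) => [<-//|Tz1s].
  apply: (convex cN NA Nz1 Nz2 Hz1 Tz1s).
  by apply: phi_ltE; [exact: aH|exact: TH Tz2|rewrite pa].
- move=> s t; rewrite !in_itv /= => hs ht st.
  by rewrite -(pa _ hs) st pa.
- apply/seteqP; split => [_ [s /= + <-]|z Hz]; first by rewrite in_itv; exact: aH.
  by exists (phi z); [rewrite /= in_itv /= phi_al // phi_be|exact: aphi].
- split; first exact: aphi.
  move=> s /andP[als sbe]; have hs : al <= s < be by rewrite ltW.
  exists (S (a s)); first exact: cut_oS (hcut (aH _ hs)).
  apply/seteqP; split => [z [Sz Hz]|_ [t /= + <-]].
    exists (phi z); last exact: aphi.
    rewrite /= in_itv /= phi_al //= -[ltRHS](pa _ hs); apply: phi_lt => //.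
    have zs : z <> a s by case: (cut_subS (hcut (aH _ hs)) Sz).
    by case: (tri Hz (aH _ hs) zs) => // /(TS (aH _ hs) Sz).
  rewrite in_itv /= => /andP[alt ts]; have ht : al <= t < be by rewrite alt (lt_trans ts).
  split; last exact: aH.
  apply: (nest (aH _ ht) _).1; last by right.
  by apply: phi_ltE; rewrite ?pa //; exact: aH.
Qed.

End order.

Lemma half_arc : exists (a : R -> X) (al be : R),
  [/\ al < be, {within `[al, be[, continuous a}, {in `[al, be[ &, injective a},
      a @` `[al, be[ = Q `|` [set c] & a al = c /\ forall s, al < s < be ->
      exists2 W, open W & W `&` (Q `|` [set c]) = a @` `[al, s[].
Proof.
have [ST hST] : {ST : X -> set X * set X & forall u, H u ->
    [/\ cut2 A u (ST u).1 (ST u).2, u = c -> (ST u).2 = Q & u <> c -> (ST u).1 c]}.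
  apply: (choice (P := fun u ST => H u ->
    [/\ cut2 A u ST.1 ST.2, u = c -> ST.2 = Q & u <> c -> ST.1 c])) => u.
  have [Hu|nH] := pselect (H u); last by exists (set0, set0).
  have [->|uc] := pselect (u = c); first by exists (L, Q).
  have Au : A u by case: Hu => [/(cut_subT cutc)[]|->].
  have [_ _ _ /(_ u Au)[S [T k]]] := cylA.
  case: (cutP k Ac) => [cu|Sc|Tc]; first by case: uc.
    by exists (S, T).
  by exists (T, S); split => //; exact: cut_sym.
apply: (@half_arc_order (fun u => (ST u).1) (fun u => (ST u).2)).
- by move=> u /hST[].
- by have [_ + _] := hST c (or_intror erefl); apply.
- by move=> u /hST[].
Qed.

End half_arc.

(** * Ends of rays and star-shaped neighborhoods *)

Section arcs.
Context {R : realType} {X : topologicalType}.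
Implicit Types (A B K W : set X) (z : X) (a : R -> X).

(** The last clause makes initial pieces relatively open, so that the end of the ray cannot
    accumulate at its own points; continuity and injectivity of [a] would permit that. *)
Definition ray (H : set X) c := exists a (al be : R),
  [/\ al < be, {within `[al, be[, continuous a}, {in `[al, be[ &, injective a},
      a @` `[al, be[ = H & a al = c /\ forall s, al < s < be ->
      exists2 W, open W & W `&` H = a @` `[al, s[].

(** Openness of the interior means that the rest of the space touches the arc only at its ends. *)
Definition arc_on K := exists a (s t : R),
  [/\ s < t, {within `[s, t], continuous a}, {in `[s, t] &, injective a},
      open (a @` `]s, t[) & K = a @` `[s, t]].

(** Only a covering is asked for, and the arcs may overlap: the property then passes to subsets and
    finite unions, as the compactness induction requires. *)
Definition graphlike A := exists (P : set X) (F : set (set X)),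
  [/\ finite_set P, finite_set F, forall K, F K -> arc_on K & A `<=` P `|` \bigcup_(K in F) K].

Lemma graphlikeS A B : A `<=` B -> graphlike B -> graphlike A.
Proof.
move=> AB [P [F [fP fF aF BF]]]; exists P, F; split => //; exact: subset_trans BF.
Qed.

Lemma graphlikeU A B : graphlike A -> graphlike B -> graphlike (A `|` B).
Proof.
move=> [P [F [fP fF aF AF]]] [P' [F' [fP' fF' aF' BF]]].
exists (P `|` P'), (F `|` F'); rewrite !finite_setU; split => //.
  by move=> K [/aF|/aF'].
move=> x [/AF[Px|[K FK Kx]]|/BF[Px|[K FK Kx]]].
- by left; left.
- by right; exists K => //; left.
- by left; right.
- by right; exists K => //; right.
Qed.

Lemma graphlike_set1 z : graphlike [set z].
Proof. by exists [set z], set0; split => //; move=> x ->; left. Qed.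

Lemma graphlike0 : graphlike set0.
Proof. by exists set0, set0; split. Qed.

Lemma graphlike_arc K : arc_on K -> graphlike K.
Proof.
move=> aK; exists set0, [set K]; split => //; first by move=> _ ->.
by move=> x Kx; right; exists K.
Qed.

Lemma near_graphlike_bigcup z (F : set (set X)) : finite_set F ->
  (forall V, F V -> exists2 N, nbhs z N & graphlike (N `&` V)) ->
  exists2 N, nbhs z N & graphlike (N `&` \bigcup_(V in F) V).
Proof.
move=> /finite_seqP[s ->]; elim: s => [|V s IH] h.
  exists setT; first exact: filterT.
  by apply: graphlikeS graphlike0 => x [_ []].
have [|N nN gN] := IH; first by move=> W sW; apply: h; rewrite /= inE; apply/orP; right.
have [|N' nN' gN'] := h V; first by rewrite /= inE eqxx.
exists (N `&` N'); first exact: filterI.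
apply: graphlikeS (graphlikeU gN gN') => x [[Nx N'x] [W /=]].
rewrite inE => /orP[/eqP->|sW] Wx; first by right.
by left; split => //; exists W.
Qed.

Hypotheses (hX : hausdorff_space X) (cX : compact [set: X]).

Section ray_end.
Variables (a : R -> X) (al be : R) (c z : X) (Q : set X).
Hypotheses (albe : al < be) (acts : {within `[al, be[, continuous a})
  (ainj : {in `[al, be[ &, injective a}) (aim : a @` `[al, be[ = Q `|` [set c])
  (aal : a al = c)
  (aW : forall s, al < s < be -> exists2 W, open W & W `&` (Q `|` [set c]) = a @` `[al, s[).
Hypotheses (oQ : open Q) (Qc : ~ Q c) (Hz : ~ (Q `|` [set c]) z).

Let aH s : al <= s < be -> (Q `|` [set c]) (a s).
Proof. by move=> h; rewrite -aim; exists s => //=; rewrite in_itv. Qed.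

Let ainj' s t : al <= s < be -> al <= t < be -> a s = a t -> s = t.
Proof. by move=> hs ht; apply: ainj; rewrite in_itv. Qed.

Let aQ s : al < s < be -> Q (a s).
Proof.
move=> /andP[als sbe]; have [|//|ac] := aH (s := s); first by rewrite ltW.
have e : al = s by apply: ainj'; rewrite ?lexx ?(ltW als) ?albe ?sbe // aal ac.
by move: als; rewrite e ltxx.
Qed.

Lemma ray_closed_part s : al < s < be -> arc_on (a @` `[al, s]).
Proof.
move=> hs; have /andP[als sbe] := hs; exists a, al, s; split => //.
- apply: continuous_subspaceW acts => u /=; rewrite !in_itv /= => /andP[-> us].
  by rewrite (le_lt_trans us sbe).
- move=> u v; rewrite !in_itv /= => /andP[alu us] /andP[alv vs].
  by apply: ainj'; rewrite ?alu ?alv; [rewrite (le_lt_trans us sbe)|rewrite (le_lt_trans vs sbe)].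
- have [W oW WH] := aW hs.
  have -> : a @` `]al, s[ = W `&` Q; last exact: openI.
  apply/seteqP; split => [_ [u /= + <-]|x [Wx Qx]].
    rewrite in_itv /= => /andP[alu us].
    have Qu : Q (a u) by apply: aQ; rewrite alu (lt_trans us).
    split => //; have : (W `&` (Q `|` [set c])) (a u); last by case.
    by rewrite WH; exists u => //=; rewrite in_itv /= ltW.
  have : (W `&` (Q `|` [set c])) x by split => //; left.
  rewrite WH => -[u /= + ux]; rewrite in_itv /= le_eqVlt => /andP[/orP[/eqP alu|alu] us].
    by exfalso; apply: Qc; rewrite -aal alu ux.
  by exists u => //=; rewrite in_itv /= alu.
Qed.

(** Sending [be] to [z] completes the ray to an arc: [z] is not on the ray, which preserves
    injectivity, and the interior is the open set [Q]. *)
Lemma ray_converging :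
  (forall N, nbhs z N -> exists2 s, al < s < be & a @` `[s, be[ `<=` N) ->
  graphlike (Q `|` [set c]).
Proof.
move=> cvg; pose b x := if x < be then a x else z.
have ba s : s < be -> b s = a s by rewrite /b => ->.
have bbe : b be = z by rewrite /b ltxx.
suff : arc_on (b @` `[al, be]).
  move=> /graphlike_arc; apply: graphlikeS; rewrite -aim => _ [s /= + <-].
  rewrite in_itv /= => /andP[als sbe]; exists s; last exact: ba.
  by rewrite /= in_itv /= als ltW.
exists b, al, be; split => //.
- apply/subspace_continuousP => x /=; rewrite in_itv /= (le_eqVlt x).
  move=> /andP[alx /orP[/eqP xbe|xbe]].
  + rewrite xbe /from_subspace bbe => N nN; have [s /andP[als sbe] sN] := cvg N nN.
    rewrite /= nbhs_simpl /= /within /=.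
    have nI : nbhs be [set` `]s, +oo[].
      by apply: open_nbhs_nbhs; split; [exact: interval_open|rewrite /= in_itv /= sbe].
    apply: filterS nI => y /=; rewrite !in_itv /= andbT => sy /andP[aly].
    rewrite le_eqVlt => /orP[/eqP->|ybe]; first by rewrite bbe; exact: nbhs_singleton.
    by rewrite ba //; apply: sN; exists y => //=; rewrite in_itv /= ltW.
  + rewrite /from_subspace ba // => N nN.
    have /subspace_continuousP/(_ x) := acts; rewrite /= in_itv /= alx => /(_ xbe N nN).
    rewrite !nbhs_simpl /= /within /= => h.
    have nI : nbhs x [set` `]-oo, be[].
      by apply: open_nbhs_nbhs; split; [exact: interval_open|rewrite /= in_itv /= xbe].
    apply: filterS (filterI h nI) => y [hy]; rewrite /= !in_itv /= => ybe /andP[aly _].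
    by rewrite ba //; apply: hy; rewrite in_itv /= aly.
- move=> u v; rewrite !in_itv /= !(le_eqVlt _ be).
  move=> /andP[alu /orP[/eqP ube|ube]] /andP[alv /orP[/eqP vbe|vbe]].
  + by rewrite ube vbe.
  + rewrite ube bbe ba // => zv; exfalso; apply: Hz; rewrite zv; apply: aH.
    by rewrite alv.
  + rewrite vbe bbe ba // => zu; exfalso; apply: Hz; rewrite -zu; apply: aH.
    by rewrite alu.
  + by rewrite !ba //; apply: ainj'; rewrite ?alu ?alv.
- have -> : b @` `]al, be[ = Q => //.
  apply/seteqP; split => [_ [u /= + <-]|x Qx].
    by rewrite in_itv /= => hu; rewrite ba; [exact: aQ|case/andP: hu].
  have : (Q `|` [set c]) x by left.
  rewrite -aim => -[u /= + ux]; rewrite in_itv /= le_eqVlt => /andP[/orP[/eqP alu|alu] us].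
    by exfalso; apply: Qc; rewrite -aal alu ux.
  by exists u; [rewrite /= in_itv /= alu|rewrite ba].
Qed.

Variable S : set X.
Hypotheses (oS : open S) (Sz : S z).
Hypothesis clH : forall B, closed B -> B `<=` S `\ z -> closed (B `&` (Q `|` [set c])).

(** If the end does not converge to [z], take a small [N] around [z]. The boundary of [N] meets the
    ray in a compact set, contained in an initial piece. The connected tail after this piece avoids
    the boundary, so it lies inside [N], which is excluded, or outside the closure of [N]; then [N]
    meets the ray in a closed initial piece only. *)
Lemma ray_end : exists2 N, nbhs z N & graphlike (N `&` (Q `|` [set c])).
Proof.
have [cvg|] := pselect (forall N, nbhs z N -> exists2 s, al < s < be & a @` `[s, be[ `<=` N).
  exists setT; first exact: filterT.
  by rewrite setTI; exact: ray_converging.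
move=> /existsNP[N0 /not_implyP[nN0 hN0]].
have clz : closed [set z] by apply: accessible_closed_set1; exact: hausdorff_accessible.
have [||N [oN zN cN]] := compact_open_between (O := N0° `&` S) hX cX clz.
  by apply: openI => //; exact: open_interior.
  by move=> _ ->; split => //; exact: nN0.
have Nz : N z by exact: zN.
pose B := closure N `\` N.
have clB : closed B.
  by rewrite /B setDE; apply: closedI; [exact: closed_closure|exact: open_closedC].
have BS : B `<=` S `\ z.
  by move=> x [/cN[_ Sx] nNx]; split => //= xz; apply: nNx; rewrite xz.
have cC : compact (B `&` (Q `|` [set c])).
  by apply: (@subclosed_compact _ _ setT) => //; exact: clH.
have [s0 s0I] : exists s, al < s < be.
  by exists ((al + be) / 2); move: albe => h; apply/andP; split; lra.
have mono s t : s <= t -> a @` `[al, s[ `<=` a @` `[al, t[.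
  move=> st _ [u /= + <-]; rewrite in_itv /= => /andP[alu us].
  by exists u => //=; rewrite in_itv /= alu (lt_le_trans us).
have [|A A' AA [s sI hs]|A A' [s sI hs] [t tI ht]|x [Bx Hx]|s1 s1I hs1] :=
  @compact_set_ind _ _ (fun A => exists2 s, al < s < be &
     A `&` (Q `|` [set c]) `<=` a @` `[al, s[) cC.
- by exists s0 => //; rewrite set0I.
- by exists s => // x [/AA A'x Hx]; exact: hs.
- exists (Num.max s t).
    have /andP[als sbe] := sI; have /andP[alt tbe] := tI.
    by rewrite lt_max als /= gt_max sbe tbe.
  move=> x [[Ax|A'x] Hx].
    by apply: (mono s); [rewrite le_max lexx|exact: hs].
  by apply: (mono t); [rewrite le_max lexx orbT|exact: ht].
- have : (Q `|` [set c]) x by [].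
  rewrite -aim => -[u /= + ux]; rewrite in_itv /= => /andP[alu ube].
  have sI : al < (u + be) / 2 < be by apply/andP; split; lra.
  have [W oW WH] := aW sI; exists W; last by exists ((u + be) / 2) => //; rewrite aim WH.
  apply: open_nbhs_nbhs; split => //.
  have : (W `&` (Q `|` [set c])) x; last by case.
  by rewrite WH; exists u => //=; rewrite in_itv /= alu /=; lra.
have /andP[als1 s1be] := s1I.
exists N; first exact: open_nbhs_nbhs.
apply: graphlikeS (graphlike_arc (ray_closed_part s1I)) => x [Nx Hx].
apply: contrapT => nx.
have cE : connected (a @` `[s1, be[).
  apply: connected_continuous_connected.
    by apply/connected_intervalP; exact: interval_is_interval.
  apply: continuous_subspaceW acts => u /=; rewrite !in_itv /= => /andP[su ->].
  by rewrite andbT (le_trans _ su) // ltW.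
have EB y : (a @` `[s1, be[) y -> B y -> False.
  move=> [u /= + <-]; rewrite in_itv /= => /andP[su ube] Bu.
  have [|v /= + vu] := hs1 (a u).
    have Hu : (Q `|` [set c]) (a u) by apply: aH; rewrite ube andbT (le_trans _ su) // ltW.
    by split => //; split.
  rewrite in_itv /= => /andP[alv vs].
  have uv : v = u.
    apply: ainj' vu; first by rewrite alv (lt_trans vs).
    by rewrite ube andbT (le_trans _ su) // ltW.
  by move: vs; rewrite uv ltNge su.
have [||||k|k] := @connected_open_split _ _ N (~` closure N) cE.
- by [].
- by apply: closed_openC; exact: closed_closure.
- move=> y Ey; have [Ny|nNy] := pselect (N y); first by left.
  by right=> cNy; apply: (EB y).
- by apply/seteqP; split => // y [_ [/subset_closure]].
- apply: hN0; exists s1 => // y /k Ny.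
  by apply: interior_subset; case: (cN y (subset_closure Ny)).
- have : (Q `|` [set c]) x by [].
  rewrite -aim => -[u /= + ux]; rewrite in_itv /= => /andP[alu ube].
  have [us|su] := leP u s1; first by apply: nx; exists u => //=; rewrite in_itv /= alu.
  apply: (k x); last exact: subset_closure.
  by exists u => //=; rewrite in_itv /= ltW.
Qed.

End ray_end.

Lemma star_graphlike z S (F : set (set X)) : open S -> S z -> finite_set F ->
  (forall V, F V -> cyl V) -> trivIset F id -> S `\ z = \bigcup_(V in F) V ->
  (forall V c L Q, F V -> V c -> cut2 V c L Q -> ray (Q `|` [set c]) c) ->
  exists2 N, nbhs z N & graphlike N.
Proof.
move=> oS Sz fF cF tF SF rF.
have [|N nN gN] := @near_graphlike_bigcup z F fF; last first.
- exists (S `&` N); first by apply: filterI => //; exact: open_nbhs_nbhs.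
  apply: graphlikeS (graphlikeU (graphlike_set1 z) gN) => x [Sx Nx].
  have [->|xz] := pselect (x = z); first by left.
  by right; split => //; rewrite -SF.
- move=> V FV; have [[c Vc] oV cV cutV] := cF _ FV.
  have [L [Q k]] := cutV c Vc.
  have half L' Q' : cut2 V c L' Q' ->
      exists2 N, nbhs z N & graphlike (N `&` (Q' `|` [set c])).
    move=> k'; have [a [al [be [ab ac ai aim [aal aW]]]]] := rF V c L' Q' FV Vc k'.
    have HV : Q' `|` [set c] `<=` V by move=> x [/(cut_subT k')[]|->].
    apply: (ray_end ab ac ai aim aal aW (cut_oT k') _ _ oS Sz).
    + by move=> /(cut_subT k')[].
    + move=> /HV Vz; have : (S `\ z) z by rewrite SF; exists V.
      by move=> [_]; apply.
    + move=> B clB BS.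
      (* Inside [S] minus [z] the complement of this ray is open: it consists of the other half of
         [V] and the other members of [F]. *)
      have -> : B `&` (Q' `|` [set c]) =
          B `&` ~` (L' `|` \bigcup_(V' in F `\ V) V').
        apply/seteqP; split => x [Bx Hx]; split => //.
          move=> [Lx|[V' [FV' VV'] V'x]].
            case: Hx => [Qx|xc]; first exact: (disjointE (cut_d k') Lx Qx).
            by have [_] := cut_subS k' Lx; rewrite xc.
          apply: VV'; apply: (tF V' V) => //; exists x; split => //; exact: HV.
        have : (S `\ z) x by exact: BS.
        rewrite SF => -[V' FV' V'x].
        have [VV'|VV'] := pselect (V' = V); last first.
          by exfalso; apply: Hx; right; exists V'.
        rewrite VV' in V'x; case: (cutP k' V'x) => [->|Lx|]; [by right| |by left].
        by exfalso; apply: Hx; left.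
      apply: closedI => //; apply: open_closedC; apply: openU; first exact: cut_oS k'.
      by apply: bigcup_open => V' [FV' _]; case: (cF _ FV').
  have [N nN gN] := half _ _ k; have [N' nN' gN'] := half _ _ (cut_sym k).
  exists (N `&` N'); first exact: filterI.
  apply: graphlikeS (graphlikeU gN gN') => x [[Nx N'x] Vx].
  case: (cutP k Vx) => [xc|Lx|Qx].
  + by left; split => //; right.
  + by right; split => //; left.
  + by left; split => //; left.
Qed.

End arcs.

(** * Finite unions of arcs are finite graphs *)

Lemma finite_max (R : realType) (A : set R) : finite_set A -> A !=set0 ->
  exists2 m, A m & forall x, A x -> x <= m.
Proof.
move=> /finite_seqP[s ->].
suff : forall x0, exists2 m, m \in x0 :: s & forall x, x \in x0 :: s -> x <= m.
  move=> h [x0 /= x0s]; have [m ms hm] := h x0; exists m.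
    by move: ms; rewrite /= inE => /orP[/eqP->|].
  by move=> x /= xs; apply: hm; rewrite inE xs orbT.
elim: s => [|y s IH] x0.
  by exists x0; rewrite ?inE // => x; rewrite inE => /eqP->.
have [m ms hm] := IH y; have [xm|mx] := leP x0 m.
  exists m; first by rewrite inE ms orbT.
  by move=> x; rewrite inE => /orP[/eqP->|/hm].
exists x0; first by rewrite inE eqxx.
by move=> x; rewrite inE => /orP[/eqP->//|/hm xm]; exact: le_trans xm (ltW mx).
Qed.

Lemma finite_min (R : realType) (A : set R) : finite_set A -> A !=set0 ->
  exists2 m, A m & forall x, A x -> m <= x.
Proof.
move=> fA [x Ax]; have [|_ [m Am <-] hm] := finite_max (finite_image -%R fA).
  by exists (- x), x.
by exists m => // y Ay; rewrite -lerN2; apply: hm; exists y.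
Qed.

Lemma compact_set_type (T : topologicalType) (A : set T) : compact A ->
  compact [set: set_type A].
Proof.
move=> cA F FF _; have FA : (set_val @ F) A.
  by apply: (@filterS _ F _ setT); [move=> x _; exact: set_valP|exact: filterT].
have [x [Ax cx]] := cA _ _ FA.
exists (SigSub (mem_set Ax)); split => // U V FU [_ [[W oW <-] /= Wx] WV].
have [||_ [[u Uu <-] Wu]] := cx (set_val @` U) W.
- by apply: (@filterS _ F _ U _ _ FU) => u Uu; exists u.
- by apply: open_nbhs_nbhs; split.
- by exists u; split => //; exact: WV.
Qed.

Section edges.
Context {R : realType} {X : topologicalType}.
Hypothesis hX : hausdorff_space X.
Implicit Types (a b : R -> X) (P E : set X).

(** Injectivity includes both ends. Pieces of an injective arc never close up, so the graph built
    from them has no loops. *)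
Definition edge_param P E b := [/\ {within `[0, 1], continuous b},
  {in `[0, 1] &, injective b}, P (b 0) /\ P (b 1), E = b @` `]0, 1[ & E `&` P = set0].

Definition edge_on P E := open E /\ exists b, edge_param P E b.

(** The interior of the piece is open since it is the open interior of the whole arc with two
    compact, hence closed, end pieces removed. *)
Lemma subarc_edge P a (s0 t0 s t : R) : {within `[s0, t0], continuous a} ->
  {in `[s0, t0] &, injective a} -> open (a @` `]s0, t0[) -> s0 <= s -> s < t ->
  t <= t0 -> P (a s) -> P (a t) -> (forall u, s < u < t -> ~ P (a u)) ->
  edge_on P (a @` `]s, t[).
Proof.
move=> ca ia oa s0s st tt0 Ps Pt nP.
have ia' u v : s0 <= u <= t0 -> s0 <= v <= t0 -> a u = a v -> u = v.
  by move=> hu hv; apply: ia; rewrite in_itv.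
have cpt u v : s0 <= u -> v <= t0 -> closed (a @` `[u, v]).
  move=> s0u vt0; apply: compact_closed => //; apply: continuous_compact; last exact: segment_compact.
  apply: continuous_subspaceW ca => x /=; rewrite !in_itv /= => /andP[ux xv].
  by rewrite (le_trans s0u ux) (le_trans xv vt0).
split.
  have -> : a @` `]s, t[ = a @` `]s0, t0[ `&` ~` (a @` `[s0, s] `|` a @` `[t, t0]).
    apply/seteqP; split => [_ [u /= + <-]|x [[u /= + ux] nx]].
      rewrite in_itv /= => /andP[su ut]; split.
        by exists u => //=; rewrite in_itv /= (le_lt_trans s0s su) (lt_le_trans ut tt0).
      have hu : s0 <= u <= t0.
        by rewrite (le_trans s0s (ltW su)) (le_trans (ltW ut) tt0).
      move=> [[v /=]|[v /=]]; rewrite in_itv /= => /andP[h1 h2] vu.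
        have e : v = u by apply: ia' => //; rewrite h1 (le_trans h2) // ltW // (lt_le_trans st).
        by move: su; rewrite -e ltNge h2.
      have e : v = u by apply: ia' => //; rewrite h2 andbT (le_trans _ h1) // (le_trans s0s (ltW st)).
      by move: ut; rewrite -e ltNge h1.
    rewrite in_itv /= => /andP[s0u ut0].
    exists u => //=; rewrite in_itv /=; apply/andP; split; rewrite ltNge; apply/negP => h.
      by apply: nx; left; exists u => //=; rewrite in_itv /= h ltW.
    by apply: nx; right; exists u => //=; rewrite in_itv /= h ltW.
  apply: openI => //; apply: closed_openC; apply: closedU; apply: cpt => //.
    by rewrite (le_trans _ tt0) // ltW.
  by rewrite (le_trans s0s) // ltW.
pose l x := s + x * (t - s); have ts : 0 < t - s by rewrite subr_gt0.
have l0 : l 0 = s by rewrite /l mul0r addr0.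
have l1 : l 1 = t by rewrite /l mul1r addrC subrK.
have lP x : 0 <= x <= 1 -> s <= l x <= t.
  move=> /andP[x0 x1]; rewrite /l; apply/andP; split; first by rewrite lerDl mulr_ge0 // ltW.
  by rewrite -lerBrDl ler_piMl // ltW.
have lP' x : 0 <= x <= 1 -> s0 <= l x <= t0.
  by move=> /lP/andP[h1 h2]; rewrite (le_trans s0s h1) (le_trans h2 tt0).
have lc : continuous l.
  move=> x; apply: cvgD; first exact: cvg_cst.
  by apply: cvgM; [exact: cvg_id|exact: cvg_cst].
have linj x y : l x = l y -> x = y.
  by move=> /addrI/(mulIf (lt0r_neq0 ts)).
exists (a \o l); split.
- apply/subspace_continuousP => x /=; rewrite in_itv /= => hx N nN.
  have /subspace_continuousP/(_ (l x)) := ca; rewrite /= in_itv /= => /(_ (lP' _ hx) N nN).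
  rewrite !nbhs_simpl /= /within /= => h.
  have := lc x _ h; rewrite /= nbhs_simpl /=; apply: filterS => y /=.
  by rewrite !in_itv /= => + hy; apply; exact: lP'.
- move=> x y; rewrite !in_itv /= => hx hy /ia' h; apply: linj; apply: h; exact: lP'.
- by rewrite /= l0 l1.
- apply/seteqP; split => [_ [u /= + <-]|_ [x /= + <-]]; rewrite in_itv /= => /andP[h1 h2].
    exists ((u - s) / (t - s)); last by rewrite /l /= divfK ?gt_eqF // addrC subrK.
    rewrite /= in_itv /= divr_gt0 ?subr_gt0 //= ltr_pdivrMr // mul1r.
    by rewrite ltrD2r.
  exists (l x) => //=; rewrite in_itv /= /l ltrDl mulr_gt0 //=.
  by rewrite -ltrBrDl gtr_pMl.
- apply/seteqP; split => // _ [[u /= + <-]]; rewrite in_itv /= => hu.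
  exact: nP.
Qed.

Lemma edge_closed P E b : edge_param P E b -> closed (b @` `[0, 1]).
Proof.
move=> [cb _ _ _ _]; apply: compact_closed => //.
by apply: continuous_compact => //; exact: segment_compact.
Qed.

Lemma edge_ends P E b x : edge_param P E b -> (b @` `[0, 1]) x -> E x \/ P x.
Proof.
move=> [_ _ [P0 P1] -> _] [u /= + <-]; rewrite in_itv /= => /andP[].
rewrite le_eqVlt => /orP[/eqP<- _|u0]; first by right.
rewrite le_eqVlt => /orP[/eqP-> |u1]; first by right.
by left; exists u => //=; rewrite in_itv /= u0.
Qed.

(** An edge is connected and avoids [P], so it cannot pass an end of the other one: the other edge
    and the complement of its closed arc are disjoint open sets that cover it. *)
Lemma edge_eq P E E' : edge_on P E -> edge_on P E' -> E `&` E' !=set0 -> E = E'.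
Proof.
have aux E1 E2 : edge_on P E1 -> edge_on P E2 -> E1 `&` E2 !=set0 -> E1 `<=` E2.
  move=> [_ [b1 [c1 _ _ e1 d1]]] [oE2 [b2 h2]] [x [E1x E2x]].
  have cE1 : connected E1.
    rewrite e1; apply: connected_continuous_connected.
      by apply/connected_intervalP; exact: interval_is_interval.
    apply: continuous_subspaceW c1 => u /=; rewrite !in_itv /= => /andP[u0 u1].
    by rewrite !ltW.
  have sub : E2 `<=` b2 @` `[0, 1].
    have [_ _ _ -> _] := h2; apply: image_subset => u /=.
    by rewrite !in_itv /= => /andP[u0 u1]; rewrite !ltW.
  have [|||//|k] := @connected_open_split _ E1 E2 (~` (b2 @` `[0, 1])) cE1 oE2.
  - exact: closed_openC (edge_closed h2).
  - move=> y E1y; have [E2y|nE2y] := pselect (E2 y); first by left.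
    right=> /(edge_ends h2)[//|Py]; exact: (disjointE d1 E1y Py).
  - by apply/seteqP; split => // y [_ [/sub]].
  - by exfalso; apply: (k _ E1x); exact: sub.
move=> h h' [x [Ex E'x]]; apply/seteqP; split; apply: aux => //; exists x; split => //.
Qed.

Lemma empty_finite_graph : (X -> False) -> is_finite_graph R X.
Proof.
move=> X0; pose G := @FinGraph void void (fun e => e) (fun e => e).
have G0 : graph_space R G -> False by move=> /repr[[]].
exists G, (fun x => False_rect _ (X0 x)), (fun y => False_rect _ (G0 y)).
by split=> [x|y|x|y]; [case: (X0 x)|case: (G0 y)|case: (X0 x)|case: (G0 y)].
Qed.

(** [Psi] sends the cells to [X] and identifies two points exactly when [attach] does. The cells
    form a compact space and [X] is Hausdorff, so [Psi] maps closed sets to closed sets, and the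
    continuous bijection that it induces has a continuous inverse. *)
Lemma graph_of_edges (x0 : X) P (EE : set (set X)) : finite_set P -> finite_set EE ->
  (forall E, EE E -> edge_on P E) -> (forall x, P x \/ exists2 E, EE E & E x) ->
  is_finite_graph R X.
Proof.
move=> /finite_seqP[vs Pvs] /finite_seqP[es EEes] hE cover.
have vsP v : v \in vs -> P v by rewrite Pvs.
have Pv v : P v -> v \in vs by rewrite Pvs.
have esE E : E \in es -> EE E by rewrite EEes.
have Ee E : EE E -> E \in es by rewrite EEes.
have [b hb] : {b : set X -> R -> X & forall E, EE E -> edge_param P E (b E)}.
  apply: (choice (P := fun E b => EE E -> edge_param P E b)) => E.
  have [EEE|nE] := pselect (EE E); last by exists (fun=> x0).
  by have [_ [b hb]] := hE _ EEE; exists b.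
pose bb (e : seq_sub es) := b (ssval e).
have hbb e : edge_param P (ssval e) (bb e) by apply/hb/esE/ssvalP.
have b0 e : bb e 0 \in vs by have [_ _ [/Pv]] := hbb e.
have b1 e : bb e 1 \in vs by have [_ _ [_ /Pv]] := hbb e.
pose G := @FinGraph (seq_sub vs) (seq_sub es) (fun e => SeqSub (b0 e)) (fun e => SeqSub (b1 e)).
exists G.
pose psi (i : vertex G + edge G) (t : R) : X :=
  match i with inl v => ssval v | inr e => bb e t end.
pose Psi (p : cells R G) : X := psi (projT1 p) (set_val (projT2 p)).
pose Psi' (c : vertex G + edge G * R) : X :=
  match c with inl v => ssval v | inr (e, t) => bb e t end.
have PsiE p : Psi p = Psi' (attach p).
  case: p => -[v|e] t //; rewrite /Psi /attach /=.
  case: eqP => [->//|_]; case: eqP => [->//|_]; by [].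
have attach_edge (p : cells R G) (e : seq_sub es) t : attach p = inr (e : edge G, t) -> (ssval e : set X) (bb e t) /\ 0 < t < 1.
  case: p => -[v|e'] t'; rewrite /attach /=; first by [].
  case: eqP => [_ //|t0]; case: eqP => [_ //|t1 [ee et]]; subst e' t.
  have := set_valP t'; rewrite /= in_itv /= => /andP[h0 h1].
  have t01 : 0 < \val t' < 1.
    by rewrite !lt_neqAle h0 h1 eq_sym; do 2 (case: eqP => //).
  split => //; have [_ _ _ eE _] := hbb e.
  suff : (bb e @` `]0, 1[) (bb e (\val t')) by rewrite -eE.
  by exists (\val t') => //=; rewrite in_itv.
have PE (e : seq_sub es) (v : seq_sub vs) x : (ssval e : set X) x -> ssval (v : seq_sub vs) = x -> False.
  move=> ex vx; have [_ _ _ _ d] := hbb e.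
  by apply: (disjointE d ex); rewrite -vx; exact/vsP/ssvalP.
have Psi_attach (p p' : cells R G) : Psi p = Psi p' -> attach p = attach p'.
  rewrite !PsiE; case e1: (attach p) => [v|[e t]]; case e2 : (attach p') => [v'|[e' t']] /=.
  - by move=> /val_inj ->.
  - by move=> /esym vb; have [h _] := attach_edge _ _ _ e2; case: (PE _ _ _ h (esym vb)).
  - by move=> vb; have [h _] := attach_edge _ _ _ e1; case: (PE _ _ _ h (esym vb)).
  - have [h1 /andP[t0 t1]] := attach_edge _ _ _ e1.
    have [h2 /andP[t0' t1']] := attach_edge _ _ _ e2.
    move=> bt; have ee : e = e'.
      apply/val_inj; apply: (@edge_eq P); [exact/hE/esE/ssvalP|exact/hE/esE/ssvalP|].
      by exists (bb e t); split => //=; rewrite bt.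
    subst e'; have [_ ib _ _ _] := hbb e.
    by rewrite (ib t t') // in_itv /= !ltW.
have Psi_cts : continuous Psi.
  apply: (@sigT_continuous _ _ _ (fun i (x : set_type (cell i)) => psi i (set_val x))) => i.
  apply/(@subspace_sigL_continuousP _ (cell i) _ (psi i)); case: i => [v|e] /=.
    by apply: continuous_subspaceT => x; exact: cvg_cst.
  by have [] := hbb e.
have Psi_surj x : exists p, Psi p = x.
  case: (cover x) => [Px|[E EEE Ex]].
    have h0 : (0 : R) \in cell (inl (SeqSub (Pv _ Px)) : vertex G + edge G) by apply/mem_set.
    by exists (existT _ (inl (SeqSub (Pv _ Px))) (SigSub h0)).
  have [_ _ _ e _] := hb _ EEE; move: (Ex); rewrite e => -[t /= + tx].
  rewrite in_itv /= => /andP[t0 t1].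
  have h0 : t \in cell (inr (SeqSub (Ee _ EEE)) : vertex G + edge G).
    by apply/mem_set; rewrite /= in_itv /= !ltW.
  by exists (existT _ (inr (SeqSub (Ee _ EEE))) (SigSub h0)).
have [h hh] := choice Psi_surj.
pose pi : cells R G -> graph_space R G := \pi_(graph_space R G)%qT.
pose g (y : graph_space R G) : X := Psi (repr y).
have piP p p' : pi p = pi p' <-> attach p = attach p'.
  split; first by move/eqmodP/eqP.
  by move=> e; apply/eqmodP/eqP.
have gpi p : g (pi p) = Psi p.
  by rewrite /g !PsiE; congr Psi'; apply/piP; rewrite /pi reprK.
have gK : cancel g (pi \o h).
  move=> y; rewrite -[RHS]reprK; apply/piP; apply: Psi_attach; exact: hh.
have hK : cancel (pi \o h) g by move=> x /=; rewrite gpi hh.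
have cg : continuous g.
  apply/quotient_continuous; rewrite (_ : _ \o _ = Psi) //; apply/funext => p; exact: gpi.
exists (pi \o h), g; split => //.
apply/continuous_closedP => C clC.
have -> : (pi \o h) @^-1` C = Psi @` (pi @^-1` C).
  apply/seteqP; split => [x /= Cx|_ [p /= Cp <-]]; first by exists (h x).
  by have /piP -> // := Psi_attach _ _ (hh (Psi p)).
apply: compact_closed => //; apply: continuous_compact; first exact: continuous_subspaceT.
apply: (@subclosed_compact _ _ setT) => //.
  by apply: closed_comp => // p _; exact: pi_continuous.
apply: sigT_compact; first exact: finite_finset.
move=> [v|e]; apply: compact_set_type; first exact: compact_set1.
exact: segment_compact.
Qed.

Lemma graphlike_finite_graph : @graphlike R X setT -> is_finite_graph R X.
Proof.
move=> [P0 [F [fP0 fF aF cov]]].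
have [[x0 _]|nX] := pselect (exists x : X, True); last first.
  by apply: empty_finite_graph => x; apply: nX; exists x.
pose isa K (p : (R -> X) * (R * R)) := [/\ p.2.1 < p.2.2,
  {within `[p.2.1, p.2.2], continuous p.1}, {in `[p.2.1, p.2.2] &, injective p.1},
      open (p.1 @` `]p.2.1, p.2.2[) & K = p.1 @` `[p.2.1, p.2.2]].
have [p hp] : {p : set X -> (R -> X) * (R * R) & forall K, F K -> isa K (p K)}.
  apply: (choice (P := fun K p => F K -> isa K p)) => K.
  have [FK|nK] := pselect (F K); last by exists (fun=> x0, (0, 0)).
  by have [a [s [t h]]] := aF _ FK; exists (a, (s, t)).
pose P := P0 `|` [set (p K).1 (p K).2.1 | K in F] `|` [set (p K).1 (p K).2.2 | K in F].
have fP : finite_set P by rewrite !finite_setU; split; [split => //|]; exact: finite_image.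
(* The subdivision parameters of [K]; they are finite in number because [P] is finite and the arc
   injective. *)
pose U K := [set u | (p K).2.1 <= u <= (p K).2.2 /\ P ((p K).1 u)].
have fU K : F K -> finite_set (U K).
  move=> FK; have [_ _ ia _ _] := hp _ FK.
  rewrite -(eq_finite_set (inj_card_eq (f := (p K).1) _)).
    by apply: sub_finite_set fP => _ [u [_ Pu] <-].
  move=> u v /set_mem [hu _] /set_mem [hv _]; apply: ia; rewrite in_itv //.
(* All pairs of subdivision parameters are candidates, which makes finiteness evident; the first
   condition discards those that bound no edge. *)
pose EE := [set E | edge_on P E] `&`
  \bigcup_(K in F) [set (p K).1 @` `]q.1, q.2[ | q in U K `*` U K].
apply: (@graph_of_edges x0 P EE) => //.
- apply: finite_setIr; apply: bigcup_finite => // K FK.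
  by apply: finite_image; apply: finite_setX; exact: fU.
- by move=> E [].
- move=> x; have [Px|nPx] := pselect (P x); [by left|right].
  have [P0x|[K FK]] := cov x I; first by exfalso; apply: nPx; left; left.
  have [st ca ia oa {1}->] := hp _ FK => -[u /=]; rewrite in_itv /=.
  move: st ca ia oa; set a := (p K).1; set s := (p K).2.1; set t := (p K).2.2.
  move=> st ca ia oa /andP[su ut] aux.
  have Us : U K s by split; [rewrite /= lexx ltW|left; right; exists K].
  have Ut : U K t by split; [rewrite /= lexx ltW|right; exists K].
  (* The subdivision parameters nearest to [u] on its two sides bound the edge through [x]. *)
  have [||l [Ul lu] hl] := @finite_max _ (U K `&` [set v | v <= u]).
  + exact/finite_setIl/fU.
  + by exists s.
  have [||r [Ur ur] hr] := @finite_min _ (U K `&` [set v | u <= v]).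
  + exact/finite_setIl/fU.
  + by exists t.
  have ne v : P (a v) -> u <> v by move=> Pv uv; apply: nPx; rewrite -aux uv.
  have [/andP[sl lt'] Pl] := Ul; have [/andP[sr rt] Pr] := Ur.
  have lu' : l < u by rewrite lt_neqAle; apply/andP; split => //; apply/eqP/nesym/ne.
  have ur' : u < r by rewrite lt_neqAle; apply/andP; split => //; apply/eqP/ne.
  exists (a @` `]l, r[); last by exists u => //=; rewrite in_itv /= lu'.
  split; last by exists K => //; exists (l, r).
  apply: (subarc_edge ca ia oa) => //; first exact: lt_trans ur'.
  move=> v /andP[lv vr] Pv.
  have Uv : U K v by split => //; rewrite (le_trans sl (ltW lv)) (le_trans (ltW vr) rt).
  have [vu|uv] := leP v u.
    by have := hl v (conj Uv vu); rewrite leNgt lv.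
  by have := hr v (conj Uv (ltW uv)); rewrite leNgt vr.
Qed.

End edges.

(** * Regular points *)

Section regular.
Context {R : realType} {T : topologicalType} (f : T -> R).

Definition open_at x := forall N, nbhs x N -> nbhs (f x) (f @` N).

(** What is kept of a submersion chart, free of coordinates: nearby levels cut the box in one
    non-empty connected plaque, and [f] is open at every point of the box. *)
Definition regular_at p := forall O, open O -> O p -> exists B,
  [/\ open B, B p, B `<=` O, forall x, B x -> open_at x &
   \forall s \near f p, (B `&` level f s) !=set0 /\ connected (B `&` level f s)].

End regular.

Lemma ball_connected (R : realType) (V : normedModType R) (x : V) (r : R) :
  connected (ball x r).
Proof.
have [r0|r0] := leP r 0.
  suff -> : ball x r = set0 by exact: connected0.
  apply/seteqP; split => // y; rewrite -ball_normE /= => h.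
  by have := lt_le_trans h r0; rewrite normr_lt0.
pose seg (y : V) (t : R) : V := x + t *: (y - x).
have segB y t : ball x r y -> 0 <= t <= 1 -> ball x r (seg y t).
  rewrite -ball_normE /= /seg => h /andP[t0 t1].
  rewrite opprD addrA subrr sub0r normrN normrZ ger0_norm // distrC.
  by apply: le_lt_trans h; rewrite ler_piMl.
have -> : ball x r = \bigcup_(y in ball x r) (seg y @` `[0, 1]).
  apply/seteqP; split => [y By|_ [y By [t /= + <-]]].
    exists y => //; exists 1; last by rewrite /seg scale1r addrC subrK.
    by rewrite /= in_itv /= ler01 lexx.
  by rewrite in_itv; exact: segB.
apply: bigcup_connected.
  exists x => y By; exists 0; last by rewrite /seg scale0r addr0.
  by rewrite /= in_itv /= lexx ler01.
move=> y By; apply: connected_continuous_connected.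
  by apply/connected_intervalP; exact: interval_is_interval.
apply: continuous_subspaceT => t; apply: cvgD; first exact: cvg_cst.
by apply: cvgZr_tmp; exact: cvg_id.
Qed.

Lemma itv_shift (R : realFieldType) (e t h : R) : 0 < h -> h <= e - t -> h <= t + e ->
  [/\ - e <= t - h <= e, - e <= t + h <= e, t - h < t & t < t + h].
Proof. by move=> h0 h1 h2; split; try (apply/andP; split); lra. Qed.

(** * Boxes for a function with positive derivative in one direction *)

Section box.
Context {R : realType} {V : normedModType R} (g : V -> R) (U : set V) (p v : V).
Hypotheses (oU : open U) (Up : U p) (cg : forall x, U x -> {for x, continuous g}).
Hypotheses (dg : forall x, U x -> derivable g x v) (g'0 : forall x, U x -> 0 < 'D_v g x).

Let line_continuous (x : V) : continuous (fun t : R => x + t *: v).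
Proof.
by move=> t; apply: cvgD; [exact: cvg_cst|apply: cvgZr_tmp; exact: cvg_id].
Qed.

Let shift_continuous (t : R) : continuous (fun x : V => x + t *: v).
Proof. by move=> x; apply: cvgD; [exact: cvg_id|exact: cvg_cst]. Qed.

Let line_increasing (x : V) (a b : R) : (forall t, a <= t <= b -> U (x + t *: v)) ->
  {in `[a, b] &, {homo (fun t => g (x + t *: v)) : s t / s < t}}.
Proof.
move=> abU; pose h t := g (x + t *: v).
have E t : (fun s : R => s^-1 *: ((h \o shift t) (s *: 1) - h t)) =
    (fun s : R => s^-1 *: ((g \o shift (x + t *: v)) (s *: v) - g (x + t *: v))).
  apply/funext => s; rewrite /h /= /shift; congr (_ *: (g _ - _)).
  by rewrite scalerDl addrCA /GRing.scale /= mulr1.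
apply: gtr0_derive1_lt_cc => [t|t|].
- rewrite in_itv /= => /andP[at' tb]; rewrite /derivable (E t).
  by apply: dg; apply: abU; rewrite !ltW.
- rewrite in_itv /= => /andP[at' tb]; rewrite derive1E /derive (E t).
  by apply: g'0; apply: abU; rewrite !ltW.
- apply/subspace_continuousP => t /=; rewrite in_itv /= => hab.
  apply: cvg_within_filter; apply: (cvg_comp _ _ (@line_continuous x t)).
  exact: cg (abU _ hab).
Qed.

(** A topological substitute for the implicit function theorem. Since [g] increases strictly along
    [v], each short line in this direction crosses each nearby level exactly once, at time [tau x];
    the plaque is the image of a ball under the continuous map sending [x] to [x + tau x *: v]. *)
Lemma box_regular : exists B, [/\ open B, B p, B `<=` U, forall x, B x -> open_at g x &
  \forall s \near g p, (B `&` g @^-1` [set s]) !=set0 /\ connected (B `&` g @^-1` [set s])].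
Proof.
have [r r0 rU] : exists2 r : R, 0 < r & ball p r `<=` U.
  have /nbhs_ballP[r /= r0 rU] : nbhs p U by exact: open_nbhs_nbhs.
  by exists r.
(* Half-length of the lines: moving by it from [ball p (r / 2)] stays in [ball p r]. The [+ 1] makes
   the denominator positive for every [v]. *)
pose e := r / (2 * (`|v| + 1)).
have v1 : 0 < `|v| + 1 by rewrite ltr_wpDl.
have e0 : 0 < e by rewrite divr_gt0 // mulr_gt0.
have ev : e * `|v| < r / 2.
  rewrite /e invfM mulrA -mulrA gtr_pMr ?divr_gt0 // mulrC ltr_pdivrMr // mul1r.
  by rewrite ltrDl.
have inU x t : ball p (r / 2) x -> - e <= t <= e -> U (x + t *: v).
  move=> px te; apply: rU; move: px; rewrite -!ball_normE /= => px.
  have h : `|t *: v| < r / 2.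
    rewrite normrZ; apply: le_lt_trans ev; rewrite ler_wpM2r // ler_norml //.
  rewrite opprD addrA; apply: le_lt_trans (ler_normB _ _) _; lra.
have incr x : ball p (r / 2) x ->
    {in `[- e, e] &, {homo (fun t => g (x + t *: v)) : s t / s < t}}.
  by move=> px; apply: line_increasing => t; exact: inU.
have r20 : 0 < r / 2 by rewrite divr_gt0.
have pp : ball p (r / 2) p by exact: ballxx.
have ein : [/\ - e \in `[- e, e], 0 \in `[- e, e] & e \in `[- e, e]].
  by split; rewrite in_itv /=; apply/andP; split; lra.
have [em e00 ep] := ein.
have lo : g (p + (- e) *: v) < g p.
  by have := incr p pp _ _ em e00; rewrite scale0r addr0; apply; lra.
have hi : g p < g (p + e *: v).
  by have := incr p pp _ _ e00 ep; rewrite scale0r addr0; apply; lra.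
(* Half of the smaller gap between [g p] and the values at the two ends of the line through [p]; the
   ends of nearby lines then stay outside the window of levels of radius [c]. *)
pose c := Num.min ((g p - g (p + (- e) *: v)) / 2) ((g (p + e *: v) - g p) / 2).
have c0 : 0 < c by rewrite lt_min !divr_gt0 // subr_gt0.
have cl : c <= (g p - g (p + (- e) *: v)) / 2 by rewrite /c ge_min lexx.
have ch : c <= (g (p + e *: v) - g p) / 2 by rewrite /c ge_min lexx orbT.
have near_g t (N : set R) : - e <= t <= e -> nbhs (g (p + t *: v)) N ->
    \forall x \near p, N (g (x + t *: v)).
  by move=> te nN; exact: (@shift_continuous t p _ (cg (inU p t pp te) nN)).
have [d d0 [dr dlo dhi]] : exists2 d : R, 0 < d & [/\ ball p d `<=` ball p (r / 2),
    forall x, ball p d x -> g (x + (- e) *: v) < g p - c &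
    forall x, ball p d x -> g p + c < g (x + e *: v)].
  have h1 : \forall x \near p, g (x + (- e) *: v) < g p - c.
    apply: (near_g (- e) [set y | y < g p - c]); first by rewrite lexx; lra.
    by apply: open_nbhs_nbhs; split; [exact: open_lt|rewrite /=; lra].
  have h2 : \forall x \near p, g p + c < g (x + e *: v).
    apply: (near_g e [set y | g p + c < y]); first by rewrite lexx andbT; lra.
    by apply: open_nbhs_nbhs; split; [exact: open_gt|rewrite /=; lra].
  have h3 : nbhs p (ball p (r / 2)) by exact: nbhsx_ballx.
  have /nbhs_ballP[d /= d0 dP] : nbhs p [set x | [/\ ball p (r / 2) x,
      g (x + (- e) *: v) < g p - c & g p + c < g (x + e *: v)]].
    by apply: filterS (filterI h3 (filterI h1 h2)) => x [? []].
  by exists d => //; split => x /dP[].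
have incr' x s t : ball p d x -> - e <= s <= e -> - e <= t <= e -> s < t ->
    g (x + s *: v) < g (x + t *: v).
  by move=> /dr px hs ht; apply: (incr x px); rewrite in_itv.
have inj' x s t : ball p d x -> - e <= s <= e -> - e <= t <= e ->
    g (x + s *: v) = g (x + t *: v) -> s = t.
  move=> px hs ht gst; have [st|ts|//] := ltgtP s t.
    by have := incr' x s t px hs ht st; rewrite gst ltxx.
  by have := incr' x t s px ht hs ts; rewrite gst ltxx.
have lineIVT x a b s : ball p d x -> - e <= a -> a < b -> b <= e ->
    g (x + a *: v) <= s <= g (x + b *: v) ->
    exists2 t, a <= t <= b & g (x + t *: v) = s.
  move=> px ea ab be hs.
  have [||t] := @IVT _ (fun t => g (x + t *: v)) a b s (ltW ab).
  - apply/subspace_continuousP => t /=; rewrite in_itv /= => /andP[at' tb].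
    apply: cvg_within_filter; apply: (cvg_comp _ _ (@line_continuous x t)).
    by apply: cg; apply: inU; [exact: dr|rewrite (le_trans ea at') (le_trans tb be)].
  - have gab : g (x + a *: v) <= g (x + b *: v).
      by apply/ltW/incr' => //; apply/andP; split => //; lra.
    by rewrite (min_idPl gab) (max_idPr gab).
  - by rewrite in_itv /= => tab gt; exists t.
(* The base is a full ball, not a disc transverse to [v]. The lines overlap, which is harmless
   because crossing times are compared along one line only. *)
pose B := \bigcup_(t in [set t : R | - e < t < e]) [set y | ball p d (y - t *: v)].
have oB : open B.
  apply: bigcup_open => t _; apply: (@open_comp _ _ (fun y => y - t *: v) (ball p d)).
    move=> y _; apply: cvgB; [exact: cvg_id|exact: cvg_cst].
  exact: ball_open.
have BP y : B y -> exists x t, [/\ y = x + t *: v, ball p d x & - e < t < e].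
  by move=> [t te By]; exists (y - t *: v), t; rewrite subrK.
have inB x t : ball p d x -> - e < t < e -> B (x + t *: v).
  by move=> px te; exists t => //=; rewrite addrK.
exists B; split => //.
- by rewrite -[p]addr0 -(scale0r v); apply: inB; [exact: ballxx|apply/andP; split; lra].
- by move=> y /BP[x [t [-> /dr px /andP[t1 t2]]]]; apply: inU => //; rewrite !ltW.
- move=> y /BP[x [t [-> px /andP[t1 t2]]]] N nN.
  have := @line_continuous x t _ nN; rewrite nbhs_simpl /= => /nbhs_ballP[d1 /= d10 d1N].
  pose h := Num.min (d1 / 2) (Num.min (e - t) (t + e)).
  have h0 : 0 < h.
    by rewrite !lt_min divr_gt0 //= subr_gt0 t2 /= -ltrBlDr sub0r.
  have [h1 h2 h3] : [/\ h <= d1 / 2, h <= e - t & h <= t + e].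
    by split; rewrite /h !ge_min lexx ?orbT.
  clearbody h; have te : - e <= t <= e by rewrite !ltW.
  have [b1 b2 b3 b4] : [/\ - e <= t - h <= e, - e <= t + h <= e, t - h < t & t < t + h].
    exact: itv_shift.
  have a1 : g (x + (t - h) *: v) < g (x + t *: v) by exact: incr'.
  have a2 : g (x + t *: v) < g (x + (t + h) *: v) by exact: incr'.
  have nI : nbhs (g (x + t *: v)) [set` `]g (x + (t - h) *: v), g (x + (t + h) *: v)[].
    by apply: open_nbhs_nbhs; split; [exact: interval_open|rewrite /= in_itv /= a1].
  apply: filterS nI => s /=; rewrite in_itv /= => /andP[s1 s2].
  have [||||u /andP[u1 u2] us] := @lineIVT x (t - h) (t + h) s px.
  + by case/andP: b1.
  + exact: lt_trans b3 b4.
  + by case/andP: b2.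
  + by rewrite !ltW.
  + exists (x + u *: v) => //; apply: d1N.
    rewrite -ball_normE /= ltr_distlC.
    have hd : h < d1 by apply: le_lt_trans h1 _; rewrite ltr_pdivrMr // ltr_pMr // ltr1n.
    by rewrite (lt_le_trans _ u1) ?(le_lt_trans u2) ?ltrD2l ?ltrN2.
- have nI : nbhs (g p) [set` `]g p - c, g p + c[].
    by apply: open_nbhs_nbhs; split; [exact: interval_open|rewrite /= in_itv /=; lra].
  apply: filterS nI => s /=; rewrite in_itv /= => /andP[s1 s2].
  have ex x : ball p d x -> exists2 t, - e < t < e & g (x + t *: v) = s.
    move=> px; have k1 := dlo x px; have k2 := dhi x px.
    have [||||t /andP[t1 t2] ts] := @lineIVT x (- e) e s px.
    + lra.
    + lra.
    + lra.
    + by apply/andP; split; lra.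
    + exists t => //; rewrite !lt_neqAle t1 t2 !andbT.
      apply/andP; split; apply/eqP => te.
        by move: k1; rewrite te ts; lra.
      by move: k2; rewrite -te ts; lra.
  have [tau htau] : {tau : V -> R & forall x, ball p d x ->
      - e < tau x < e /\ g (x + tau x *: v) = s}.
    apply: (choice (P := fun x t => ball p d x -> - e < t < e /\ g (x + t *: v) = s)).
    move=> x; have [px|npx] := pselect (ball p d x); last by exists 0.
    by have [t te ts] := ex x px; exists t.
  have pd : ball p d p by exact: ballxx.
  (* The crossing time is trapped: [g] is below [s] at time [t - h] and above it at [t + h], both
     strict inequalities persist on nearby lines, and monotonicity puts their crossing times in
     between. *)
  have ctau : {within ball p d, continuous (fun x => x + tau x *: v)}.
    rewrite continuous_open_subspace; last exact: ball_open.
    move=> x /set_mem px; apply: cvgD; first exact: cvg_id.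
    apply: cvgZr_tmp; apply/cvgrPdist_le => k k0.
    have [/andP[t1 t2] gs] := htau x px; set t := tau x in t1 t2 gs *.
    pose h := Num.min k (Num.min (e - t) (t + e)).
    have h0 : 0 < h.
      by rewrite !lt_min k0 /= subr_gt0 t2 /= -ltrBlDr sub0r.
    have [h1 h2 h3] : [/\ h <= k, h <= e - t & h <= t + e].
      by split; rewrite /h !ge_min lexx ?orbT.
    clearbody h; have te : - e <= t <= e by rewrite !ltW.
    have [bm bp tm tp] : [/\ - e <= t - h <= e, - e <= t + h <= e, t - h < t & t < t + h].
      exact: itv_shift.
    have a1 : g (x + (t - h) *: v) < s by rewrite -gs; exact: incr'.
    have a2 : s < g (x + (t + h) *: v) by rewrite -gs; exact: incr'.
    have cgx u (N : set R) : - e <= u <= e -> nbhs (g (x + u *: v)) N ->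
        \forall y \near x, N (g (y + u *: v)).
      by move=> ue nN; exact: (@shift_continuous u x _ (cg (inU x u (dr _ px) ue) nN)).
    have n1 : \forall y \near x, g (y + (t - h) *: v) < s.
      apply: (cgx (t - h) [set z | z < s]) => //.
      by apply: open_nbhs_nbhs; split; [exact: open_lt|].
    have n2 : \forall y \near x, s < g (y + (t + h) *: v).
      apply: (cgx (t + h) [set z | s < z]) => //.
      by apply: open_nbhs_nbhs; split; [exact: open_gt|].
    have n3 : nbhs x (ball p d) by apply: open_nbhs_nbhs; split; [exact: ball_open|].
    apply: filterS (filterI n3 (filterI n1 n2)) => y [py [y1 y2]].
    have [/andP[u1 u2] gy] := htau y py; set u := tau y in u1 u2 gy *.
    have b1 : g (y + (t - h) *: v) < s by [].
    have b2 : s < g (y + (t + h) *: v) by [].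
    have ue : - e <= u <= e by rewrite !ltW.
    rewrite ler_distl; apply/andP; split; rewrite leNgt; apply/negP => hu.
      have thu : t + h < u by rewrite -ltrBrDr; apply: lt_le_trans hu _; rewrite lerD2l lerN2.
      by have := incr' y _ _ py bp ue thu; rewrite gy ltNge (ltW b2).
    have uth : u < t - h by rewrite ltrBrDr; apply: le_lt_trans hu; rewrite lerD2l.
    by have := incr' y _ _ py ue bm uth; rewrite gy ltNge (ltW b1).
  have -> : B `&` g @^-1` [set s] = (fun x => x + tau x *: v) @` ball p d.
    apply/seteqP; split => [y [/BP[x [t [-> px te]]] /= gs]|_ [x px <-]].
      exists x => //; have [te' gs'] := htau x px; congr (_ + _ *: _).
      move: te te' => /andP[? ?] /andP[? ?].
      by apply: (inj' x) => //; rewrite ?gs //; rewrite !ltW.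
    by have [te' gs'] := htau x px; split => //; exact: inB.
  split; first by exists (p + tau p *: v), p.
  by apply: connected_continuous_connected => //; exact: ball_connected.
Qed.

End box.

(** * Contours without critical points *)

Section charts.
Context {R : realType} {m : nat} {T : topologicalType} (c : chart R m T).
Let D := chart_dom c.

Lemma chart_cts_at x : D x -> {for x, continuous c}.
Proof.
move=> Dx; have := @chart_fun_continuous _ _ _ c.
by rewrite continuous_open_subspace; [apply; exact/mem_set|exact: chart_dom_open].
Qed.

Lemma chart_inv_cts_at y : (c @` D) y -> {for y, continuous (chart_inv c)}.
Proof.
move=> Dy; have := @chart_inv_continuous _ _ _ c.
by rewrite continuous_open_subspace; [apply; exact/mem_set|exact: chart_img_open].
Qed.

Lemma chart_preimage_open B : open B -> open (D `&` c @^-1` B).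
Proof.
apply: (continuous_inP _ (chart_dom_open c)).1 => x /set_mem; exact: chart_cts_at.
Qed.

Lemma chart_image_open O : open O -> open (c @` (D `&` O)).
Proof.
move=> oO; have -> : c @` (D `&` O) = c @` D `&` chart_inv c @^-1` O.
  apply/seteqP; split => [_ [x [Dx Ox] <-]|_ [[x Dx <-] /=]].
    by split; [exists x|rewrite /= chart_funK].
  by rewrite chart_funK // => Ox; exists x.
have /(continuous_inP _ (@chart_img_open _ _ _ c)) : {in c @` D, continuous (chart_inv c)}.
  by move=> y /set_mem; exact: chart_inv_cts_at.
exact.
Qed.

Lemma chart_preimageE B : B `<=` c @` D -> D `&` c @^-1` B = chart_inv c @` B.
Proof.
move=> BD; apply/seteqP; split => [x [Dx Bx]|_ [y By <-]].
  by exists (c x) => //; exact: chart_funK.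
have [x Dx xy] := BD _ By; rewrite -xy in By *; rewrite chart_funK //.
Qed.

Lemma chart_preimage_connected B : B `<=` c @` D -> connected B ->
  connected (D `&` c @^-1` B).
Proof.
move=> BD cB; rewrite chart_preimageE //; apply: connected_continuous_connected => //.
apply: continuous_subspaceW BD _; exact: (@chart_inv_continuous _ _ _ c).
Qed.

End charts.

Section manifold.
Context {R : realType} {m : nat} (M : smoothManifold R m).

Lemma manifold_locally_connected : locally_connected M.
Proof.
move=> x O oO Ox; have [c ac Dx] := atlas_cover x.
have oW := @chart_image_open _ _ _ c _ oO.
have : nbhs (c x) (c @` (chart_dom c `&` O)).
  by apply: open_nbhs_nbhs; split => //; exists x.
move=> /nbhs_ballP[e /= e0 eW].
have eD : ball (c x) e `<=` c @` chart_dom c.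
  by move=> y /eW[u [Du _] <-]; exists u.
exists (chart_dom c `&` c @^-1` ball (c x) e); split.
- by apply: chart_preimage_open; exact: ball_open.
- by apply: chart_preimage_connected => //; exact: ball_connected.
- by split => //; exact: ballxx.
- rewrite chart_preimageE // => _ [y /eW[u [Du Ou] <-] <-].
  by rewrite chart_funK.
Qed.

Variable f : M -> R.
Hypothesis hf : smooth_fun f.

Lemma smooth_fun_continuous : continuous f.
Proof.
move=> x; have [c ac Dx] := atlas_cover x.
have cg := hf ac 0%N; have cc := chart_cts_at Dx.
move=> N nN; rewrite /= nbhs_simpl /=.
have : nbhs (c x) ((f \o chart_inv c) @^-1` N).
  by apply: cg; [exists x|rewrite /= chart_funK].
move=> /cc; rewrite /= nbhs_simpl /= => h.
have nD : nbhs x (chart_dom c) by apply: open_nbhs_nbhs; split => //; exact: chart_dom_open.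
by apply: filterS (filterI nD h) => y [Dy]; rewrite /= chart_funK.
Qed.

Lemma noncritical_regular p : ~ critical_point f p -> regular_at f p.
Proof.
move=> ncp O oO Op; have [c ac Dp] := atlas_cover p.
pose g := f \o chart_inv c; pose D := chart_dom c.
have hg : smooth_on (c @` D) g := hf ac.
have dg x : (c @` D) x -> differentiable g x by move=> Dx; have [/(_ x Dx)] := hg 1%N.
(* A nonzero derivative is positive in some direction or in the opposite one. *)
have [v v0] : exists v, 0 < 'D_v g (c p).
  apply: contrapT => h; apply: ncp; exists c; split => // v.
  have dgp : differentiable g (c p) by apply: dg; exists p.
  apply/eqP; rewrite eq_le !leNgt; apply/andP; split; apply/negP => k; apply: h.
    by exists v; rewrite deriveE.
  by exists (- v); rewrite deriveE // linearN oppr_gt0.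
pose W := c @` (D `&` O).
have WD : W `<=` c @` D by move=> _ [x [Dx _] <-]; exists x.
have oW : open W := @chart_image_open _ _ _ c _ oO.
(* Open because the derivative along [v] is continuous; it is positive on all of [U]. *)
pose U := W `&` ('D_v g) @^-1` [set y | 0 < y].
have oU : open U.
  apply: (continuous_inP _ oW).1; last exact: open_gt.
  by move=> x /set_mem Wx; have [_ /(_ v x (WD _ Wx))] := hg 1%N.
have [||||B [oB Bp BU opB locB]] := @box_regular _ _ g U (c p) v oU.
- by split => //; exists p.
- by move=> x [Wx _]; have := hg 0%N x (WD _ Wx).
- by move=> x [Wx _]; apply: diff_derivable; exact: dg (WD _ Wx).
- by move=> x [].
have BD : B `<=` c @` D by move=> y /BU[/WD].
have gE x : D x -> g (c x) = f x by move=> Dx; rewrite /g /= chart_funK.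
have plaque s : D `&` c @^-1` B `&` level f s = D `&` c @^-1` (B `&` g @^-1` [set s]).
  apply/seteqP; split => x.
    by move=> [[Dx Bx] fx]; split => //; split => //=; rewrite gE.
  by move=> [Dx [Bx /= gx]]; split => //; rewrite /level /= -gE.
exists (D `&` c @^-1` B); split.
- exact: chart_preimage_open.
- by split.
- move=> x [Dx /= /BU[[u [Du Ou] uc] _]].
  by rewrite -(chart_funK Dx) -uc chart_funK.
- move=> x [Dx Bx] N nN.
  have : nbhs (c x) (chart_inv c @^-1` N).
    by apply: chart_inv_cts_at; [exists x|rewrite /= chart_funK].
  move=> /(opB _ Bx); rewrite gE //; apply: filterS => _ [y Ny <-].
  by exists (chart_inv c y).
- rewrite -(gE p Dp); apply: filterS locB => s [[y [By gy]] cs].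
  rewrite plaque; split; last first.
    apply: chart_preimage_connected => //.
    by apply: subset_trans BD; exact: subIsetl.
  by rewrite chart_preimageE; [exists (chart_inv c y), y|apply: subset_trans BD; exact: subIsetl].
Qed.

End manifold.

Section regular_contour.
Context {R : realType} {T : topologicalType} (f : T -> R).
Hypotheses (cf : continuous f) (hT : hausdorff_space T) (cT : compact [set: T]).
Local Notation X := (reeb_space f).
Local Notation q := (reeb_map f).

Lemma reeb_map_connected (A : set T) s x y : connected A -> A `<=` level f s ->
  A x -> A y -> q x = q y.
Proof.
move=> cA As Ax Ay; apply/reeb_mapP; split; first by rewrite (As _ Ax) (As _ Ay).
by exists A => //; split => // z /As; rewrite (As _ Ax).
Qed.

(* For levels near that of the contour [z], the plaques of any two regular boxes
   centered on [z] lie in a common contour: this is an equivalence relation between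
   the points of [z] with open classes, and [z] is connected. *)
Lemma regular_contour_graphlike (z : X) :
  (forall p, q p = z -> regular_at f p) ->
  exists2 N, nbhs z N & @graphlike R X N.
Proof.
move=> reg; set t := reeb_fun z.
have Ct p : q p = z -> f p = t by move=> qp; rewrite /t -qp reeb_funE.
have [B hB] : {B : T -> set T & forall p, q p = z -> [/\ open (B p), B p p,
    (forall x, B p x -> open_at f x) & \forall s \near t,
    (B p `&` level f s) !=set0 /\ connected (B p `&` level f s)]}.
  apply: (choice (P := fun p B => q p = z -> [/\ open B, B p,
    (forall x, B x -> open_at f x) & \forall s \near t,
    (B `&` level f s) !=set0 /\ connected (B `&` level f s)])) => p.
  have [qp|nqp] := pselect (q p = z); last by exists set0.
  have [B [oB Bp _ op loc]] := reg _ qp setT openT I.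
  by exists B => _; split => //; rewrite -(Ct _ qp).
pose near_same A A' := \forall s \near t, forall x x',
  A x -> f x = s -> A' x' -> f x' = s -> q x = q x'.
have same_plaque p : q p = z -> near_same (B p) (B p).
  move=> /hB[_ _ _]; apply: filterS => s [_ cs] x x' Bx fx Bx' fx'.
  by apply: (reeb_map_connected (s := s) cs) => //; exact: subIsetr.
have near_ne p : q p = z -> \forall s \near t, (B p `&` level f s) !=set0.
  by move=> /hB[_ _ _]; apply: filterS => s [].
have all_same p p' : q p = z -> q p' = z -> near_same (B p) (B p').
  move=> qp qp'; apply: (@connected_equiv _ (q @^-1` [set z])
    (fun p p' => near_same (B p) (B p'))) => //; first exact: reeb_fiber_connected.
  - move=> x y w qx qy qw xy wy.
    apply: filterS3 (near_ne y qy) xy wy => s [u [Bu fu]] h h' a b Ba fa Bb fb.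
    by rewrite (h a u) // (h' b u).
  (* For [y] close to [x], openness of [f] at [y] puts on each nearby level a point common to both
     boxes, which links their plaques. *)
  - move=> x qx; have [oBx Bxx _ _] := hB _ qx.
    apply: filterS (open_nbhs_nbhs (conj oBx Bxx)) => y Bxy qy.
    have [oBy Byy opy _] := hB _ qy.
    have nI : nbhs y (B x `&` B y) by apply: open_nbhs_nbhs; split => //; exact: openI.
    have := opy _ Byy _ nI; rewrite (Ct _ qy) => h.
    apply: filterS3 h (same_plaque _ qx) (same_plaque _ qy).
    move=> s [u [Bxu Byu] fu] h1 h2 a b Ba fa Bb fb.
    by rewrite (h1 a u) // (h2 u b).
have [p0 qp0] := reeb_map_surj z.
have cC : compact (q @^-1` [set z]).
  by apply: (@subclosed_compact _ _ setT) => //; exact: reeb_fiber_closed.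
have [|A A' AA [W [oW AW opW sW]]|A A' [W [oW AW opW sW]] [W' [oW' AW' opW' sW']]|p qp|W [oW CW opW sW]] :=
  @compact_set_ind _ _ (fun A => exists W, [/\ open W, A `<=` W,
    forall x, W x -> open_at f x & near_same W (B p0)]) cC.
- exists set0; split => //; first exact: open0.
  by apply: (@filterS _ (nbhs t) _ setT); [move=> s _ x x' []|exact: filterT].
- by exists W; split => //; exact: subset_trans AW.
- exists (W `|` W'); split.
  + exact: openU.
  + by apply: setUSS.
  + by move=> x [/opW|/opW'].
  + by move: sW sW'; rewrite /near_same; apply: filterS2 => s h h' x x' [Wx|Wx]; [exact: h|exact: h'].
- have [oB Bp op _] := hB _ qp; exists (B p); first exact: open_nbhs_nbhs.
  by exists (B p); split => //; exact: all_same.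
have [G [oG Gz GW]] := reeb_saturated_nbhd cf hT cT oW CW.
have [_ Bp0 opp0 _] := hB _ qp0.
have nG : \forall s \near t, exists2 x, G (q x) & f x = s.
  have := opp0 _ Bp0 (q @^-1` G); rewrite (Ct _ qp0); apply.
  apply: open_nbhs_nbhs; split; first exact/reeb_openP.
  by rewrite /= qp0.
(* On each level of this window [G] has exactly one point, so [a] below is a section of [reeb_fun]
   with values in [G]. *)
have /nbhs_ballP[e /= e0 eP] : nbhs t [set s | (exists2 x, G (q x) & f x = s) /\
    forall y y', G (q y) -> f y = s -> G (q y') -> f y' = s -> q y = q y'].
  apply: filterS3 nG (near_ne _ qp0) sW => s h [u [Bu fu]] h'.
  split => // y y' Gy fy Gy' fy'.
  by rewrite (h' y u) //; [rewrite (h' y' u) //; exact: GW|exact: GW].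
have [sg hsg] : {sg : R -> T & forall s, ball t e s -> G (q (sg s)) /\ f (sg s) = s}.
  apply: (choice (P := fun s x => ball t e s -> G (q x) /\ f x = s)) => s.
  have [ts|nts] := pselect (ball t e s); last by exists p0.
  by have [[x Gx fx] _] := eP _ ts; exists x.
pose a s := q (sg s).
have aE s y : ball t e s -> G y -> reeb_fun y = s -> y = a s.
  move=> ts Gy ys; have [x xy] := reeb_map_surj y.
  have [Gs fs] := hsg _ ts; have [_ h] := eP _ ts.
  rewrite -xy; apply: h => //; first by rewrite xy.
  by rewrite -reeb_funE xy.
have te s : t - e / 2 <= s <= t + e / 2 -> ball t e s.
  by rewrite /ball /= => hs; rewrite ltr_distl; lra.
have imE : a @` `]t - e / 2, t + e / 2[ =
    G `&` @reeb_fun _ _ f @^-1` `]t - e / 2, t + e / 2[.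
  apply/seteqP; split => [_ [s /= hs <-]|y [Gy /= hy]].
    have [|Gs fs] := hsg s; first by apply: te; move: hs; rewrite in_itv /=; lra.
    by split => //=; rewrite reeb_funE fs.
  exists (reeb_fun y) => //; apply/esym/aE => //.
  by apply: te; move: hy; rewrite in_itv /=; lra.
have oI : open (a @` `]t - e / 2, t + e / 2[).
  rewrite imE; apply: openI => //; apply: open_comp; last exact: interval_open.
  by move=> y _; exact: reeb_fun_cts.
exists (a @` `]t - e / 2, t + e / 2[).
  apply: (@open_nbhs_nbhs X); split => //; rewrite imE; split => //=.
  by rewrite -/t in_itv /=; lra.
apply: (@graphlikeS _ _ _ (a @` `[t - e / 2, t + e / 2])).
  apply: image_subset => s /=; rewrite !in_itv /=; lra.
apply: graphlike_arc; exists a, (t - e / 2), (t + e / 2); split => //.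
- lra.
(* Continuity of the section comes from openness of [f]: the image of a neighborhood of [sg s]
   contains all levels near [s]. *)
- apply/subspace_continuousP => s /=; rewrite in_itv /= => hs N nN.
  have ts := te _ hs; have [Gs fs] := hsg _ ts.
  pose O := (N : set X)°; have Os : O (a s) by exact: nN.
  have oO : open O by exact: open_interior.
  have ON : O `<=` N by exact: interior_subset.
  have nOG : nbhs (sg s) (q @^-1` (O `&` G)).
    by apply: open_nbhs_nbhs; split; [apply/reeb_openP; exact: openI|split].
  have := opW _ (GW _ Gs) _ nOG; rewrite fs => nI.
  rewrite /= nbhs_simpl /= /within /=; apply: filterS nI => s' [u [Ou Gu] fu].
  rewrite in_itv /= => hs'; apply: ON.
  by rewrite /from_subspace -(aE s' (q u)) //; [exact: te|rewrite reeb_funE].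
- move=> s s'; rewrite !in_itv /= => hs hs' ss.
  have [_ fs] := hsg _ (te _ hs); have [_ fs'] := hsg _ (te _ hs').
  rewrite -[s]fs -[s']fs' -(reeb_funE f (sg s)) -(reeb_funE f (sg s')).
  exact: congr1 ss.
Qed.

End regular_contour.

(** * Stars in the realization of a graph *)

Lemma connected_star (T : topologicalType) (A : set T) x : A x ->
  (forall y, A y -> exists B, [/\ connected B, B `<=` A, B x & B y]) -> connected A.
Proof.
move=> Ax h; suff -> : A = connected_component A x by exact: component_connected.
apply/seteqP; split; last exact: connected_component_sub.
by move=> y /h[B [cB BA Bx By]]; exists B.
Qed.

Section graph_stars.
Context {R : realType} (G : finGraph).
Local Notation Y := (graph_space R G).
Local Notation code := (vertex G + edge G * R)%type.
Let pi : cells R G -> Y := \pi_Y%qT.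
(** Normal form of a point of the quotient: a vertex, or an edge with a parameter strictly between 0
    and 1. *)
Let coord (y : Y) : code := attach (repr y).

Let piP p p' : pi p = pi p' <-> attach p = attach p'.
Proof.
split; first by move/eqmodP/eqP.
by move=> e; apply/eqmodP/eqP.
Qed.

Let coord_pi p : coord (pi p) = attach p.
Proof. by apply/piP; rewrite /pi reprK. Qed.

Let coord_inj y y' : coord y = coord y' -> y = y'.
Proof. by move=> e; rewrite -[y]reprK -[y']reprK; apply/piP. Qed.

Let cell_point (p : cells R G) : [\/ exists v, attach p = inl v,
  exists e, attach p = inl (source e) /\ projT1 p = inr e /\ set_val (projT2 p) = 0,
  exists e, attach p = inl (target e) /\ projT1 p = inr e /\ set_val (projT2 p) = 1 |
  exists e t, attach p = inr (e, t) /\ 0 < t < 1].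
Proof.
case: p => -[v|e] t; first by constructor 1; exists v.
rewrite /attach /=; case: eqP => [t0|t0].
  by constructor 2; exists e.
case: eqP => [t1|t1]; first by constructor 3; exists e.
constructor 4; exists e, (\val t); split => //.
have := set_valP t; rewrite /= in_itv /= => /andP[h0 h1].
by rewrite !lt_neqAle h0 h1 eq_sym !andbT; apply/andP; split; apply/eqP.
Qed.

Let coordP y : (exists v, coord y = inl v) \/
  exists e t, coord y = inr (e, t) /\ 0 < t < 1.
Proof.
case: (cell_point (repr y)) => [[v h]|[e [h _]]|[e [h _]]|[e [t h]]].
- by left; exists v.
- by left; exists (source e).
- by left; exists (target e).
- by right; exists e, t.
Qed.

Let attach_edge (e : edge G) (t : set_type (@cell R G (inr e))) :
  attach (existT (fun i => set_type (@cell R G i)) (inr e) t) =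
  if \val t == 0 then inl (source e) else
  if \val t == 1 then inl (target e) else inr (e, \val t).
Proof. by []. Qed.

(** Openness in the quotient is tested cell by cell. Vertex cells are single points and impose
    nothing, so one condition for each edge remains. *)
Let open_coord (Z : set code) :
  (forall e, exists2 O : set R, open O & forall t, 0 <= t <= 1 ->
    Z (if t == 0 then inl (source e) else if t == 1 then inl (target e) else inr (e, t))
    <-> O t) -> open [set y | Z (coord y)].
Proof.
move=> h; suff : open (pi @^-1` [set y | Z (coord y)]) by [].
have -> : pi @^-1` [set y | Z (coord y)] = [set p | Z (attach p)].
  by apply/seteqP; split => p /=; rewrite coord_pi.
apply/sigT_openP => -[v|e].
  have [Zv|nZv] := pselect (Z (inl v)).
    by rewrite (_ : _ @^-1` _ = setT); [exact: openT|apply/seteqP; split].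
  by rewrite (_ : _ @^-1` _ = set0); [exact: open0|apply/seteqP; split].
have [ O oO hO] := h e; exists O => //; apply/seteqP; split => t /=;
  have := set_valP t; rewrite /= in_itv /= => /hO ht; rewrite attach_edge.
  exact: ht.2.
exact: ht.1.
Qed.

Let in01 e : @cell R G (inr e) 0.
Proof. by rewrite /= in_itv /= lexx ler01. Qed.

Let arc e (s t : R) : set Y :=
  [set y | exists u, coord y = inr (e, u) /\ s < u < t].

(** Made total in order to use continuity within the unit interval; outside of it the value is that
    at 0. *)
Let pt e : R -> Y :=
  valL_ (pi (existT (fun i => set_type (@cell R G i)) (inr e)
      (SigSub (mem_set (in01 e)))))
    (fun u : set_type (@cell R G (inr e)) =>
       pi (existT (fun i => set_type (@cell R G i)) (inr e) u)).

Let ptE e (u : set_type (@cell R G (inr e))) :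
  pt e (\val u) = pi (existT (fun i => set_type (@cell R G i)) (inr e) u).
Proof. by rewrite /pt; exact: (congr1 (fun k => k _ u) (sigL_valL _)). Qed.

Let coord_pt e t : 0 <= t <= 1 -> coord (pt e t) =
  if t == 0 then inl (source e) else if t == 1 then inl (target e) else inr (e, t).
Proof.
move=> ht; have h : @cell R G (inr e) t by rewrite /= in_itv.
by rewrite -[t]/(\val (SigSub (mem_set h))) ptE coord_pi attach_edge.
Qed.

Let coord_pt_in e t : 0 < t < 1 -> coord (pt e t) = inr (e, t).
Proof. by move=> /andP[t0 t1]; rewrite coord_pt ?ltW // gt_eqF // lt_eqF. Qed.

Let pt_cts e : {within `[0, 1], continuous (pt e)}.
Proof.
apply/subspace_valL_continuousP' => u; apply: (@continuous_comp _ _ _ _ pi).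
  exact: existT_continuous.
exact: pi_continuous.
Qed.

Let pt_connected e (i : interval R) : [set` i] `<=` `[0, 1] -> connected (pt e @` [set` i]).
Proof.
move=> h; apply: connected_continuous_connected.
  by apply/connected_intervalP; exact: interval_is_interval.
exact: continuous_subspaceW h (pt_cts (e := e)).
Qed.

Let arc_image e s t : 0 <= s -> t <= 1 -> arc e s t = pt e @` `]s, t[.
Proof.
move=> s0 t1; apply/seteqP; split => [y [u [yu /andP[su ut]]]|_ [u /= + <-]].
  exists u; first by rewrite /= in_itv /= su.
  by apply: coord_inj; rewrite yu coord_pt_in // (le_lt_trans s0 su) (lt_le_trans ut t1).
rewrite in_itv /= => /andP[su ut]; exists u.
by rewrite coord_pt_in ?su // (le_lt_trans s0 su) (lt_le_trans ut t1).
Qed.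

Let arc_connected e s t : 0 <= s -> t <= 1 -> connected (arc e s t).
Proof.
move=> s0 t1; rewrite arc_image //; apply: pt_connected => u /=.
by rewrite !in_itv /= => /andP[su ut]; rewrite ltW ?(le_lt_trans s0) // ltW // (lt_le_trans ut).
Qed.

Let arc_open e s t : 0 <= s -> t <= 1 -> open (arc e s t).
Proof.
move=> s0 t1.
apply: (@open_coord [set k | exists u, k = inr (e, u) /\ s < u < t]) => e'.
have [<-|ne] := pselect (e = e'); last first.
  exists set0; first exact: open0.
  move=> u hu /=; split => // -[w [+ _]]; case: ifP => // _; case: ifP => // _.
  by move=> [/esym].
exists [set` `]s, t[]; first exact: interval_open.
move=> u hu /=; rewrite in_itv /=; split.
  by move=> [w [+ wst]]; case: ifP => // _; case: ifP => // _ [->].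
move=> /andP[su ut]; exists u; rewrite su ut; split => //.
by rewrite gt_eqF ?(le_lt_trans s0 su) // lt_eqF // (lt_le_trans ut t1).
Qed.

Let arc_neq0 e s t : 0 <= s -> s < t -> t <= 1 -> arc e s t !=set0.
Proof.
move=> s0 st t1; exists (pt e ((s + t) / 2)), ((s + t) / 2).
by rewrite coord_pt_in; [split => //; lra|lra].
Qed.

Let arc_cut e s t u y : 0 <= s -> t <= 1 -> s < u < t -> coord y = inr (e, u) ->
  cut2 (arc e s t) y (arc e s u) (arc e u t).
Proof.
move=> s0 t1 /andP[su ut] yu.
have u0 : 0 <= u by lra.
have u1 : u <= 1 by lra.
split; try exact: arc_open; try exact: arc_connected; try exact: arc_neq0.
- apply/seteqP; split => // x [[w [xw wI]] [w' [xw' wI']]].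
  by move: xw'; rewrite xw => -[ww]; subst w'; lra.
- apply/seteqP; split => [x [[w [xw wI]] xy]|x [|] [w [xw wI]]].
  + have wu : w <> u by move=> wu; apply: xy; apply: coord_inj; rewrite xw yu wu.
    by have [h|h|//] := ltgtP w u; [left|right]; exists w; split => //; lra.
  + split; first by exists w; split => //; lra.
    by move=> xy; move: xw; rewrite xy yu => -[]; lra.
  + split; first by exists w; split => //; lra.
    by move=> xy; move: xw; rewrite xy yu => -[]; lra.
Qed.

Let arc_cyl e s t : 0 <= s -> s < t -> t <= 1 -> cyl (arc e s t).
Proof.
move=> s0 st t1; split; [exact: arc_neq0|exact: arc_open|exact: arc_connected|].
by move=> y [u [yu uI]]; exists (arc e s u), (arc e u t); exact: arc_cut.
Qed.

(** Edges are cut at 1/2 and their halves indexed by a boolean, [true] for the target end, so that a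
    loop contributes two different branches to the star of its vertex. *)
Let lo (b : bool) : R := if b then 1 / 2 else 0.
Let hi (b : bool) : R := if b then 1 else 1 / 2.
Let half (k : edge G * bool) := arc k.1 (lo k.2) (hi k.2).
Let endpoint (k : edge G * bool) := if k.2 then target k.1 else source k.1.

Let lohi b : [/\ 0 <= lo b, lo b < hi b & hi b <= 1].
Proof. by rewrite /lo /hi; case: b; split; lra. Qed.

Let star v : set Y := [set y | coord y = inl v \/ exists2 k, endpoint k = v & half k y].

Let star_open v : open (star v).
Proof.
apply: (@open_coord [set c | c = inl v \/ exists2 k, endpoint k = v &
  exists u, c = inr (k.1, u) /\ lo k.2 < u < hi k.2]) => e.
(* For a loop at [v] both alternatives apply, and the star meets the edge in everything except the
   midpoint. *)
exists [set u | (source e = v /\ u < 1 / 2) \/ (target e = v /\ 1 / 2 < u)].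
  have op (P : Prop) (O : set R) : open O -> open [set u | P /\ O u].
    move=> oO; have [p|np] := pselect P.
      by rewrite (_ : mkset _ = O) //; apply/seteqP; split => u // [].
    by rewrite (_ : mkset _ = set0); [exact: open0|apply/seteqP; split => u // []].
  by apply: openU; apply: op; [exact: open_lt|exact: open_gt].
move=> u /andP[u0 u1] /=; have [->|nu0] := eqVneq u 0.
  split; first by case=> [[->]|[k _ [w [//]]]]; left; split => //; lra.
  by case=> [[-> _]|[_ h]]; [left|exfalso; lra].
have [->|nu1] := eqVneq u 1.
  split; first by case=> [[->]|[k _ [w [//]]]]; right; split => //; lra.
  by case=> [[_ h]|[-> _]]; [exfalso; lra|left].
split; first by case=> // -[[e' []] /= kv [w [[-> ->]]]]; rewrite /lo /hi /= => h;
  [right|left]; split => //; lra.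
have up : 0 < u by rewrite lt_neqAle eq_sym nu0.
have ul : u < 1 by rewrite lt_neqAle nu1.
case=> -[ev hu]; right; [exists (e, false) => //|exists (e, true) => //];
  exists u; split => //; rewrite /lo /hi /=; lra.
Qed.

Let star_connected v : connected (star v).
Proof.
have h0 : @cell R G (inl v) 0 by [].
pose x := pi (existT (fun i => set_type (@cell R G i)) (inl v) (SigSub (mem_set h0))).
have xv : coord x = inl v by rewrite coord_pi.
apply: (@connected_star _ _ x); first by left.
move=> y [yv|[[e b] kv [u [yu uI]]]].
  have -> : y = x by apply: coord_inj; rewrite yv.
  by exists [set x]; split => //; [exact: connected1|move=> _ ->; left].
rewrite /endpoint /lo /hi /= in kv yu uI.
pose i : interval R := if b then `]1 / 2, 1] else `[0, 1 / 2[.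
have iP w : w \in i -> 0 <= w <= 1 by rewrite /i; case: b {kv uI i}; rewrite in_itv /=; lra.
exists (pt e @` [set` i]); split.
- by apply: pt_connected => w /= /iP; rewrite in_itv.
- move=> _ [w /= wi <-]; have := iP _ wi; have := wi.
  rewrite /i /star /=; case: b {i iP wi} kv uI => kv uI; rewrite in_itv /= => h1 h2.
    have [w1|w1] := eqVneq w 1.
      by left; rewrite coord_pt // w1 oner_eq0 eqxx kv.
    right; exists (e, true) => //; exists w; rewrite /lo /hi /= coord_pt_in; first by split => //; lra.
    by move/eqP in w1; lra.
  have [w1|w1] := eqVneq w 0.
    by left; rewrite coord_pt // w1 eqxx kv.
  right; exists (e, false) => //; exists w; rewrite /lo /hi /= coord_pt_in; first by split => //; lra.
  by move/eqP in w1; lra.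
- rewrite /i; case: b {i iP} kv uI => kv uI.
    exists 1; first by rewrite /= in_itv /=; lra.
    by apply: coord_inj; rewrite coord_pt ?lexx ?ler01 // oner_eq0 eqxx kv xv.
  exists 0; first by rewrite /= in_itv /=; lra.
  by apply: coord_inj; rewrite coord_pt ?lexx ?ler01 // eqxx kv xv.
- exists u; last by apply: coord_inj; rewrite coord_pt_in //; case: b {i iP kv} uI; lra.
  by rewrite /i; case: b {i iP kv} uI; rewrite /= in_itv /=; lra.
Qed.

Lemma graph_star (y : Y) : exists S (F : set (set Y)),
  [/\ open S, connected S, S y, finite_set F & forall V, F V -> cyl V] /\
  trivIset F id /\ S `\ y = \bigcup_(V in F) V.
Proof.
have [[v yv]|[e [t [yt /andP[t0 t1]]]]] := coordP y; last first.
  exists (arc e 0 1), [set arc e 0 t; arc e t 1].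
  have k : cut2 (arc e 0 1) y (arc e 0 t) (arc e t 1).
    by apply: arc_cut => //; rewrite t0.
  split; [split|split] => //.
  - exact: arc_open.
  - exact: arc_connected.
  - by exists t; rewrite t0.
  - by move=> V [->|->]; apply: arc_cyl => //; exact: ltW.
  - by move=> V W [->|->] [->|->] // [x [Sx Tx]]; exfalso;
      [exact: (disjointE (cut_d k) Sx Tx)|exact: (disjointE (cut_d k) Tx Sx)].
  - rewrite (cut_E k); apply/seteqP; split => x.
      by case=> h; [exists (arc e 0 t) => //; left|exists (arc e t 1) => //; right].
    by move=> [V [->|->]] h; [left|right].
exists (star v), [set half k | k in [set k | endpoint k = v]].
split; [split|split].
- exact: star_open.
- exact: star_connected.
- by left.
- by apply: finite_image; exact: finite_finset.
- move=> _ [k _ <-]; have [a b c] := lohi k.2; exact: arc_cyl.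
- move=> _ _ [[e b] _ <-] [[e' b'] _ <-] [x [[u [xu uI]] [u' [xu' uI']]]].
  move: xu'; rewrite xu => -[ee uu]; rewrite /= in ee; subst e' u'.
  by congr (half (_, _)); clear xu; move: uI uI'; rewrite /lo /hi /=; case: b; case: b' => //; lra.
- apply/seteqP; split => [x [[xv|[k kv kx]] xy]|x [_ [k kv <-] kx]].
  + by case: xy; apply: coord_inj; rewrite xv.
  + by exists (half k) => //; exists k.
  + split; first by right; exists k.
    by move=> xy; move: kx => [u []]; rewrite xy yv.
Qed.

End graph_stars.

(** * The equivalence *)

Section two_components.
Context {T : topologicalType}.
Implicit Types A P Q : set T.

Lemma components_two P Q : open P -> open Q -> connected P -> connected Q ->
  P !=set0 -> Q !=set0 -> P `&` Q = set0 -> (components (P `|` Q) #= `I_2)%card.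
Proof.
move=> oP oQ cP cQ [a Pa] [b Qb] d.
have comp (x : T) (S S' : set T) : open S -> open S' -> connected S -> S `&` S' = set0 -> S x ->
    connected_component (S `|` S') x = S.
  move=> oS oS' cS dS Sx; apply/seteqP; split; last first.
    by apply: connected_component_max => // y; left.
  have Cx : connected_component (S `|` S') x x.
    by apply: connected_component_refl; left.
  have [||//|k] := @connected_open_split _ _ S S' (@component_connected _ (S `|` S') x) oS oS'.
  - exact: connected_component_sub.
  - by rewrite dS setI0.
  - by exfalso; exact: (disjointE dS Sx (k _ Cx)).
have CE : components (P `|` Q) = [set P; Q].
  apply/seteqP; split => [_ [x [Px|Qx] <-]|_ [->|->]].
  - by left; exact: comp.
  - by right; rewrite setUC; apply: comp => //; rewrite setIC.
  - by exists a; [left|exact: comp].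
  - by exists b; [right|rewrite setUC; apply: comp => //; rewrite setIC].
have PQ : P != Q by apply/eqP => PQ; apply: (disjointE d Pa); rewrite -PQ.
rewrite CE; apply/card_set_bijP; exists (fun S => if S == P then 0%N else 1%N); split.
- by move=> S _ /=; case: ifP.
- move=> S S' /set_mem [->|->] /set_mem [->|->] //=; rewrite eqxx.
    by rewrite eq_sym (negbTE PQ).
  by rewrite eq_sym (negbTE PQ).
- move=> [|[|n]] //= _; first by exists P; [left|rewrite eqxx].
  by exists Q; [right|rewrite eq_sym (negbTE PQ)].
Qed.

Lemma two_components A : (components A #= `I_2)%card -> exists x y,
  [/\ A x, A y, connected_component A x `&` connected_component A y = set0 &
  A = connected_component A x `|` connected_component A y].
Proof.
move=> /card_set_bijP[i [fi inji sur]].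
have [_ [x Ax <-] ix] : (i @` components A) 0%N by exact: sur.
have [_ [y Ay <-] iy] : (i @` components A) 1%N by exact: sur.
exists x, y; split => //.
  apply/seteqP; split => // z [/same_connected_component xz /same_connected_component yz].
  by move: ix; rewrite xz -yz iy.
apply/seteqP; split; last by rewrite subUset; split; exact: connected_component_sub.
move=> z Az; have cz := connected_component_refl Az.
have cA w : A w -> connected_component A w \in components A.
  by move=> Aw; apply/mem_set; exists w.
have := fi (connected_component A z) (ex_intro2 _ _ z Az erefl).
case iz : (i _) => [|[|//]] _.
  by left; rewrite -(inji _ _ (cA z Az) (cA x Ax) (etrans iz (esym ix))).
by right; rewrite -(inji _ _ (cA z Az) (cA y Ay) (etrans iz (esym iy))).
Qed.

End two_components.

Lemma second_countable_dense_seq (T : topologicalType) (x0 : T) :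
  @second_countable T -> exists d : nat -> T, dense_seq d.
Proof.
move=> [B /countable_injP[i ii] [Bo Bb]].
(* [i] numbers the basis injectively; an index that belongs to no non-empty basic set receives
   [x0]. *)
have [d hd] : {d : nat -> T & forall n U, B U -> i U = n -> U !=set0 -> U (d n)}.
  apply: (choice (P := fun n x => forall U, B U -> i U = n -> U !=set0 -> U x)) => n.
  have [[U [BU iU [x Ux]]]|nU] := pselect (exists U, [/\ B U, i U = n & U !=set0]).
    exists x => V BV iV _; have -> // : V = U.
    by apply: ii; rewrite ?inE // iV.
  by exists x0 => U BU iU U0; exfalso; apply: nU; exists U.
exists d => O oO [x Ox].
have [U [BU Ux] UO] := Bb x O (open_nbhs_nbhs (conj oO Ox)).
by exists (i U); apply: UO; apply: hd => //; exists x.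
Qed.

(** * From star-like neighborhoods of contours to stars in the Reeb space *)

Section contours.
Context {R : realType} {T : topologicalType} (f : T -> R).
Hypotheses (cf : continuous f) (hT : hausdorff_space T) (cT : compact [set: T]).
Hypothesis lT : locally_connected T.
Local Notation X := (reeb_space f).
Local Notation q := (reeb_map f).

Lemma contour_fiber z : contour f (q @^-1` [set z]).
Proof.
have [x <-] := reeb_map_surj z; exists (f x); rewrite reeb_fiber.
by exists x.
Qed.

Lemma contourP C : contour f C -> exists z, C = q @^-1` [set z].
Proof. by move=> [t [x <- <-]]; exists (q x); rewrite reeb_fiber. Qed.

(** The components left after removing a contour are open by local connectedness, and saturated
    because the remaining fibers are connected; hence their images are open, connected and
    disjoint. *)
Lemma cylindrical_cyl V : cylindrical f V -> cyl (q @` V).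
Proof.
move=> [[x Vx] oV cV sV hV]; split.
- by exists (q x), x.
- exact: saturated_open.
- apply: connected_continuous_connected => //.
  by apply: continuous_subspaceT; exact: reeb_map_cts.
- move=> u Vu; have [a [b [Aa Ab d E]]] := two_components (hV u Vu).
  set A := V `\` _ in Aa Ab d E.
  have oA : open A.
    by rewrite /A setDE; apply: openI => //; apply: closed_openC; exact: reeb_fiber_closed.
  have sC w : saturated f (connected_component A w).
    apply/saturatedP => y y' Cy yy'; apply: connected_component_trans (Cy) _.
    have [Vy yu] := connected_component_sub Cy.
    exists (q @^-1` [set q y]) => //; split => //; last exact: reeb_fiber_connected.
    move=> v /= vy; split; last by rewrite /= vy.
    by move/saturatedP : sV; apply; [exact: Vy|].
  have ne w : A w -> q @` connected_component A w !=set0.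
    by move=> Aw; exists (q w), w => //; exact: connected_component_refl.
  have co w : connected (q @` connected_component A w).
    apply: connected_continuous_connected; first exact: component_connected.
    by apply: continuous_subspaceT; exact: reeb_map_cts.
  have op w : open (q @` connected_component A w).
    by apply: saturated_open => //; exact: component_open.
  exists (q @` connected_component A a), (q @` connected_component A b).
  split => //; [exact: ne|exact: ne| |].
  + apply/seteqP; split => // _ [[y Cy <-] [y' Cy' yy']].
    apply: (disjointE d Cy).
    by move/saturatedP : (sC b); apply; [exact: Cy'|].
  + rewrite -image_setU -E; apply/seteqP; split => [_ [[y Vy <-] yu]|_ [y [Vy yu] <-]].
      by exists y.
    by split => //; exists y.
Qed.

Lemma star_like_graphlike (d : nat -> X) C U z : dense_seq d ->
  C = q @^-1` [set z] -> star_like f C U -> exists2 N, nbhs z N & @graphlike R X N.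
Proof.
move=> dd -> [oU cU sU CU [F [fF hF tF UC]]].
have FU V : F V -> V `<=` U.
  by move=> FV x Vx; have [] : (U `\` q @^-1` [set z]) x by rewrite UC; exists V.
have Fz V x : F V -> V x -> q x <> z.
  by move=> FV Vx; have [] : (U `\` q @^-1` [set z]) x by rewrite UC; exists V.
(* Compactness bounds the function, which keeps the suprema of oscillations in [half_arc] finite. *)
have [K FK] : exists K : R, forall y, `|@reeb_fun _ _ f y| <= K.
  have /compact_bounded [K [_ hK]] :=
    continuous_compact (continuous_subspaceT (reeb_fun_cts cf)) (@reeb_compact _ _ f cT).
  exists (K + 1) => y; apply: (hK (K + 1)); first by rewrite ltrDl.
  by exists y.
apply: (@star_graphlike R X (reeb_hausdorff cf hT cT) (reeb_compact cT) z (q @` U)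
  [set q @` V | V in F]).
- exact: saturated_open.
- by have [x xz] := reeb_map_surj z; exists x => //; apply: CU.
- exact: finite_image.
- by move=> _ [V /hF hV <-]; exact: cylindrical_cyl.
- move=> _ _ [V FV <-] [W FW <-] [_ [[x Vx <-] [y Wy yx]]].
  have [_ _ _ sV _] := hF _ FV.
  have Vy : V y by move/saturatedP : sV; apply; [exact: Vx|].
  by rewrite (tF V W) //; exists y.
- apply/seteqP; split => [_ [[x Ux <-] xz]|_ [_ [V FV <-] [x Vx <-]]].
    have : (U `\` q @^-1` [set z]) x by split.
    by rewrite UC => -[V FV Vx]; exists (q @` V); [exists V|exists x].
  split; last exact: Fz Vx.
  by exists x => //; exact: FU Vx.
- move=> _ c L Q [V FV <-] Vc k.
  apply: (half_arc (reeb_hausdorff cf hT cT) (reeb_locally_connected lT) dd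
    (reeb_fun_cts cf) FK _ (cylindrical_cyl (hF _ FV)) Vc k).
  by move=> B t cB Bt; exact: reeb_light Bt.
Qed.

End contours.

(** * From stars in a homeomorphic space back to star-like neighborhoods *)

Section pullback.
Context {R : realType} {T Y : topologicalType} (f : T -> R).
Local Notation X := (reeb_space f).
Local Notation q := (reeb_map f).
Variables (h : X -> Y) (k : Y -> X).
Hypotheses (ch : continuous h) (ck : continuous k) (hK : cancel h k) (kK : cancel k h).

Let pre (B : set Y) : set T := q @^-1` (h @^-1` B).

Let pre_open B : open B -> open (pre B).
Proof.
move=> oB; have oh : open (h @^-1` B : set X) by apply: open_comp => // x _; exact: ch.
exact: oh.
Qed.

Let hE B : h @^-1` B = k @` B.
Proof.
apply/seteqP; split => [x /= Bx|_ [y By <-]]; last by rewrite /= kK.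
by exists (h x).
Qed.

Let pre_connected B : open B -> connected B -> connected (pre B).
Proof.
move=> oB cB; apply: connected_preimage_open.
  by apply: open_comp => // x _; exact: ch.
by rewrite hE; apply: connected_continuous_connected => //; exact: continuous_subspaceT.
Qed.

Let pre_ex y : exists x, h (q x) = y.
Proof. by have [x xy] := reeb_map_surj (k y); exists x; rewrite xy kK. Qed.

Let pre_ne B : B !=set0 -> pre B !=set0.
Proof. by move=> [y By]; have [x xy] := pre_ex y; exists x; rewrite /pre /= xy. Qed.

(** The two sides of a cut pull back to disjoint non-empty open sets, which are connected because
    the fibers of the quotient map are; so they are the two components. *)
Lemma cyl_pullback B : cyl B -> cylindrical f (pre B).
Proof.
move=> [B0 oB cB hB]; split; [exact: pre_ne|exact: pre_open|exact: pre_connected| |].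
  exact: saturated_preimage.
move=> _ [x Bx <-]; have [S [Q kut]] := hB _ Bx.
have -> : pre B `\` q @^-1` [set q x] = pre S `|` pre Q.
  rewrite -[RHS]/(pre (S `|` Q)) -(cut_E kut).
  apply/seteqP; split => y [By xy]; split => //= e; apply: xy; last by rewrite /= e.
  exact: (can_inj hK).
apply: components_two.
- exact: pre_open (cut_oS kut).
- exact: pre_open (cut_oT kut).
- exact: pre_connected (cut_oS kut) (cut_cS kut).
- exact: pre_connected (cut_oT kut) (cut_cT kut).
- exact: pre_ne (cut_S0 kut).
- exact: pre_ne (cut_T0 kut).
- by rewrite -[LHS]/(pre (S `&` Q)) (cut_d kut).
Qed.

Lemma star_pullback z S (F : set (set Y)) : open S -> connected S -> S (h z) ->
  finite_set F -> (forall V, F V -> cyl V) -> trivIset F id ->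
  S `\ h z = \bigcup_(V in F) V -> star_like f (q @^-1` [set z]) (pre S).
Proof.
move=> oS cS Sz fF cF tF SF; split.
- exact: pre_open.
- exact: pre_connected.
- exact: saturated_preimage.
- by move=> x /= xz; rewrite /pre /= xz.
exists [set pre V | V in F]; split.
- exact: finite_image.
- by move=> _ [V /cF cV <-]; exact: cyl_pullback.
- move=> _ _ [V FV <-] [W FW <-] [x [Vx Wx]].
  by rewrite (tF V W) //; exists (h (q x)).
- apply/seteqP; split => [x [Sx xz]|x [_ [V FV <-] Vx]].
    have : (S `\ h z) (h (q x)) by split => // e; apply: xz; exact: (can_inj hK).
    by rewrite SF => -[V FV Vx]; exists (pre V) => //; exists V.
  have : (S `\ h z) (h (q x)) by rewrite SF; exists V.
  by move=> [Sx xz]; split => // e; apply: xz; rewrite /= e.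
Qed.

End pullback.

Theorem theorem2p7 (R : realType) (m : nat) (M : smoothManifold R m)
    (f : M -> R) (hm : (2 <= m)%N) (hM : compact [set: M])
    (hf : smooth_fun f) :
  is_finite_graph R (reeb_space f) <->
  (forall C : set M, critical_contour f C -> exists U : set M, star_like f C U).
Proof.
have cf := smooth_fun_continuous hf.
have hT := @manifold_hausdorff _ _ M.
split=> [[G [h [k [ch ck hK kK]]]] C [/contourP[z ->] _]|star].
  have [S [F [[oS cS Sz fF cF] [tF SF]]]] := graph_star (h z).
  by eexists; exact: star_pullback ch ck hK kK _ _ _ oS cS Sz fF cF tF SF.
(* A dense sequence needs a point to take values in; the empty manifold gives the empty graph. *)
have [[x0 _]|M0] := pselect (exists x : M, True); last first.
  apply: empty_finite_graph => z; apply: M0.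
  by have [x _] := reeb_map_surj z; exists x.
have [d dd] := second_countable_dense_seq x0 (@manifold_second_countable _ _ M).
have qdd : dense_seq (reeb_map f \o d).
  move=> O oO [z Oz]; have [x xz] := reeb_map_surj z.
  by apply: (dd (reeb_map f @^-1` O)) => //; exists x; rewrite /= xz.
apply: graphlike_finite_graph; first exact: reeb_hausdorff.
apply: (compact_set_ind (@reeb_compact _ _ f hM)).
- exact: graphlike0.
- exact: graphlikeS.
- exact: graphlikeU.
move=> z _; have [[p pz cp]|ncp] := pselect (exists2 p, reeb_map f p = z & critical_point f p).
  have [|U hU] := star (reeb_map f @^-1` [set z]).
    by split; [exact: contour_fiber|exists p].
  exact: (star_like_graphlike cf hT hM (@manifold_locally_connected _ _ M) qdd erefl hU).
apply: regular_contour_graphlike => // p pz; apply: noncritical_regular => // cp.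
by apply: ncp; exists p.
Qed.
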